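(* Let $d\ge2$, $\varrho\ge0$, and let $\mathsf{w}$ be a doubling weight on $\mathbb{X}_0^{d+1}$ such that $\mathsf{w}(x,t)=\mathsf{w}(x,-t)$. Let $n$ be a positive integer, $0<\delta\le1$, and let $\Xi$ be a symmetric maximal $\frac{\delta}{n}$-separated subset of $\mathbb{X}_0^{d+1}$. (i) For all $0<p<\infty$ and all $f\in\Pi_m^E(\mathbb{X}_0^{d+1})$ with $n\le m\le cn$, $$\sum_{(z,\tau)\in\Xi}\Big(\max_{(x,t)\in\mathsf{c}_\varrho((z,\tau),\frac{\delta}{n})}|f(x,t)|^p\Big)\,\mathsf{w}\big(\mathsf{c}_\varrho((z,\tau),\tfrac{\delta}{n})\big)\le c_{\mathsf{w},p}\,\|f\|_{p,\mathsf{w}}^p,$$ where $c_{\mathsf{w},p}$ depends on $p$ when $p$ is close to $0$ and on the doubling constant of $\mathsf{w}$. (ii) For $0<r<1$ there is a $\delta_r>0$ such that for $\delta\le\delta_r$, $r\le p<\infty$ and $f\in\Pi_n^E(\mathbb{X}_0^{d+1})$, $$\|f\|_{p,\mathsf{w}}^p\le c_{\mathsf{w},r}\sum_{(z,\tau)\in\Xi}\Big(\min_{(x,t)\in\mathsf{c}_\varrho((z,\tau),\frac{\delta}{n})}|f(x,t)|^p\Big)\,\mathsf{w}\big(\mathsf{c}_\varrho((z,\tau),\tfrac{\delta}{n})\big),$$ where $c_{\mathsf{w},r}$ depends only on the doubling constant of $\mathsf{w}$ and on $r$ when $r$ is close to $0$.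
   Context: For $\varrho\ge0$, $\mathbb{X}_0^{d+1}=\{(x,t)\in\mathbb{R}^d\times\mathbb{R}:\|x\|^2=t^2-\varrho^2,\ \varrho\le|t|\le\sqrt{\varrho^2+1}\}$ (a double conic surface if $\varrho=0$, a hyperbolic surface of two sheets if $\varrho>0$), with upper part $\{t\ge0\}$ and lower part $\{t\le0\}$. Distance. For $\varrho=0$ and all $(x,t),(y,s)\in\mathbb{X}_0^{d+1}$, $\mathsf{d}_{\mathbb{X}_0}^0((x,t),(y,s))=\mathsf{d}_{\mathbb{X}_0}((x,t),(y,s))=\arccos\big(\langle x,y\rangle+\sqrt{1-t^2}\sqrt{1-s^2}\big)$. For $\varrho>0$ the two parts are disjoint, and the distance is defined for two points both in the upper part or both in the lower part by $\mathsf{d}_{\mathbb{X}_0}^\varrho((x,t),(y,s))=\arccos\big(\langle x,y\rangle+\sqrt{1+\varrho^2-t^2}\sqrt{1+\varrho^2-s^2}\big)$; accordingly, for $\varrho>0$, conditions involving the distance refer to points in the same part. The ball is $\mathsf{c}_\varrho((x,t),\rho)=\{(y,s)\in\mathbb{X}_0^{d+1}:\mathsf{d}_{\mathbb{X}_0}^\varrho((x,t),(y,s))\le\rho\}$. Weights. The surface measure is $d\sigma_\varrho(x,t)=d\omega_{\sqrt{t^2-\varrho^2}}(x)\,dt$, where $d\omega_\rho$ is the surface measure on the sphere of radius $\rho$ in $\mathbb{R}^d$. For a nonnegative weight $\mathsf{w}$, $\mathsf{w}(E)=\int_E\mathsf{w}\,d\sigma_\varrho$ and $\|f\|_{p,\mathsf{w}}=\big(\int_{\mathbb{X}_0^{d+1}}|f|^p\,\mathsf{w}\,d\sigma_\varrho\big)^{1/p}$.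 The weight is doubling if there is $L>0$ with $\mathsf{w}(\mathsf{c}_\varrho(z,2\rho))\le L\,\mathsf{w}(\mathsf{c}_\varrho(z,\rho))$ for all $z\in\mathbb{X}_0^{d+1}$ and $\rho\in(0,r_0)$, where $r_0$ is the largest positive number such that $\mathsf{c}_\varrho(z,\rho)\subset\mathbb{X}_0^{d+1}$; the smallest such $L$ is the doubling constant. Polynomials. $\Pi_n^E(\mathbb{X}_0^{d+1})$ is the space of restrictions $p$ to $\mathbb{X}_0^{d+1}$ of polynomials of degree at most $n$ satisfying $p(x,t)=p(x,-t)$ for all $(x,t)\in\mathbb{X}_0^{d+1}$. Point sets. A discrete set $\Xi\subset\mathbb{X}_0^{d+1}$ is $\varepsilon$-separated if $\mathsf{d}_{\mathbb{X}_0}^\varrho(z,z')\ge\varepsilon$ for every two distinct points $z,z'\in\Xi$. It is maximal if there is a constant $c_d>1$ with $1\le\sum_{z\in\Xi}\chi_{\mathsf{c}_\varrho(z,\varepsilon)}(y)\le c_d$ for all $y\in\mathbb{X}_0^{d+1}$, where $\chi_E$ is the characteristic function of $E$. It is (evenly) symmetric if $(0,0)\notin\Xi$ and $\{(z,\tau)\in\Xi:\tau<0\}=\{(-z,-\tau):(z,\tau)\in\Xi,\ \tau>0\}$. In (i), $c$ is a fixed positive constant.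
   Formalization: The constants are taken as K^p, with K depending on the doubling constant and on p (resp. r) only near 0; with constants not growing with p, both inequalities fail as p→∞ (w=1, n=1, f=x_1). *)

(* Defs.v *)
From HB Require Import structures.
From mathcomp Require Import all_boot all_order all_algebra.
From mathcomp Require Import all_classical all_reals all_analysis.
From mathcomp Require Import measurable_realfun.
Set Implicit Arguments.
Unset Strict Implicit.
Unset Printing Implicit Defensive.
Import Order.TTheory GRing.Theory Num.Theory.
Import numFieldNormedType.Exports.
Local Open Scope classical_set_scope.
Local Open Scope ring_scope.

(* The sigma-algebra on R^n generated by the coordinates, i.e. the Borel sets
   when T is the type of real numbers. *)
Definition rV_display : measure_display -> measure_display.
Proof. exact. Qed.

Section measurable_rV.
Context d (T : measurableType d) (n : nat).

Let coord (i : 'I_n) (x : 'rV[T]_n) : T := x ord0 i.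

Let rV_set0 : g_sigma_preimage coord set0.
Proof. exact: sigma_algebra0. Qed.

Let rV_setC A : g_sigma_preimage coord A -> g_sigma_preimage coord (~` A).
Proof. exact: sigma_algebraC. Qed.

Let rV_bigcup (F : _^nat) : (forall i, g_sigma_preimage coord (F i)) ->
  g_sigma_preimage coord (\bigcup_i (F i)).
Proof. exact: sigma_algebra_bigcup. Qed.

HB.instance Definition _ := @isMeasurable.Build (rV_display d)
  'rV[T]_n (g_sigma_preimage coord) rV_set0 rV_setC rV_bigcup.

End measurable_rV.

Lemma measurable_coord d (T : measurableType d) n (i : 'I_n) :
  measurable_fun [set: 'rV[T]_n] (fun x => x ord0 i).
Proof.
move=> _ Y mY; rewrite setTI; apply: sub_sigma_algebra => /=.
rewrite -bigcup_seq/=; exists i => /=; first by rewrite mem_index_enum.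
by exists Y => //; rewrite setTI.
Qed.

Lemma measurable_fun_rV d1 d2 (T1 : measurableType d1) (T2 : measurableType d2)
    n (f : T1 -> 'rV[T2]_n) :
  (forall i, measurable_fun [set: T1] (fun x => f x ord0 i)) ->
  measurable_fun [set: T1] f.
Proof.
move=> mf _ Y mY; rewrite setTI.
suff : g_sigma_preimage (fun (i : 'I_n) (x : 'rV[T2]_n) => x ord0 i)
   `<=` image_set_system [set: T1] f measurable.
  by move=> /(_ _ mY); rewrite /image_set_system/= setTI.
apply: smallest_sub; first exact/sigma_algebra_image/sigma_algebra_measurable.
rewrite -bigcup_seq => A [i _ [B mB <-]].
rewrite /image_set_system/= !setTI.
by have := mf i measurableT B mB; rewrite setTI.
Qed.

Section lebesgue_rV.
Variable R : realType.
Local Open Scope ereal_scope.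

(* Lebesgue measure on R^n, by slicing along the first coordinate. *)
Fixpoint lebesgue_rV n : set 'rV[R]_n -> \bar R :=
  match n with
  | 0%N => fun A => \d_(0%R : 'rV[R]_0) A
  | n'.+1 => fun A => \int[lebesgue_measure]_t
      lebesgue_rV [set x : 'rV[R]_n' | A (row_mx (t%:M : 'rV_1) x)]
  end.


Lemma measurable_row_mx n :
  measurable_fun [set: R * 'rV[R]_n]
    (fun z => row_mx (z.1%:M : 'rV_1) z.2 : 'rV[R]_n.+1).
Proof.
apply: measurable_fun_rV => i.
have [j ij|j ij] := splitP (i : 'I_(1 + n)).
  rewrite (_ : (fun _ => _) = fst) ?measurable_fst//.
  apply/funext => z.
  have -> : i = lshift n (ord0 : 'I_1) by apply/val_inj; rewrite /= ij ord1.
  by apply: etrans (row_mxEl _ _ _ _) _; rewrite mxE.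
rewrite (_ : (fun _ => _) = (fun x : 'rV[R]_n => x ord0 j) \o snd).
  by apply: measurableT_comp => //; exact: measurable_coord.
apply/funext => z.
have -> : i = rshift 1 j by apply/val_inj; rewrite /= ij.
exact: (row_mxEr (z.1%:M : 'rV_1) z.2).
Qed.


Let split_rV n (y : 'rV[R]_n.+1) : R * 'rV[R]_n :=
  (y ord0 ord0, \row_j y ord0 (lift ord0 j)).

Let measurable_split_rV n : measurable_fun setT (@split_rV n).
Proof.
apply/measurable_fun_pairP; split; first exact: measurable_coord.
apply: measurable_fun_rV => i.
rewrite (_ : (fun _ => _) = (fun y : 'rV[R]_n.+1 => y ord0 (lift ord0 i))).
  exact: measurable_coord.
by apply/funext => y; rewrite /= mxE.
Qed.

Let split_rVK n (z : R * 'rV[R]_n) :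
  split_rV (row_mx (z.1%:M : 'rV_1) z.2 : 'rV[R]_n.+1) = z.
Proof.
case: z => t x; congr pair => /=.
  have -> : ord0 = lshift n (ord0 : 'I_1) by apply/val_inj.
  by apply: etrans (row_mxEl _ _ _ _) _; rewrite mxE.
apply/rowP => j; rewrite mxE.
have -> : lift ord0 j = rshift 1 j by apply/val_inj.
exact: row_mxEr.
Qed.

Let lebesgue_rV_prop n : [/\ lebesgue_rV (set0 : set 'rV[R]_n) = 0,
  forall A : set 'rV[R]_n, 0 <= lebesgue_rV A,
  semi_sigma_additive (@lebesgue_rV n) &
  sigma_finite setT (@lebesgue_rV n)].
Proof.
elim: n => [|n [m0 m_ge0 msa msf]].
  split; [exact: measure0|by move=> A; exact: measure_ge0
    |exact: (@measure_semi_sigma_additive _ _ _ (\d_(0%R : 'rV[R]_0)))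
    |exact: (sigma_finiteT \d_(0%R : 'rV[R]_0))].
pose H1 := isMeasure.Build _ _ _ (@lebesgue_rV n) m0 m_ge0 msa.
pose m' : {measure set 'rV[R]_n -> \bar R} := HB.pack (@lebesgue_rV n) H1.
pose H2 := Measure_isSigmaFinite.Build _ _ _ m' msf.
pose m : {sigma_finite_measure set 'rV[R]_n -> \bar R} := HB.pack (@lebesgue_rV n) H1 H2.
pose f (z : R * 'rV[R]_n) : 'rV[R]_n.+1 := row_mx (z.1%:M : 'rV_1) z.2.
have mf : measurable_fun setT f := @measurable_row_mx n.
pose leb : {sigma_finite_measure set (measurableTypeR R) -> \bar R} :=
  @lebesgue_measure R.
pose P : {measure set (measurableTypeR R * 'rV[R]_n)%type -> \bar R} :=
  leb \x m.
pose M := measure_function_pushforward__canonical__measure_function_Measure P mf.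
have ME A : lebesgue_rV A = M A.
  rewrite /= /pushforward /=; apply: eq_integral => t _ /=.
  by congr lebesgue_rV; apply/seteqP; split => x; rewrite /xsection/= inE.
have {ME} -> : @lebesgue_rV n.+1 = M by apply/funext => A; rewrite ME.
split; [exact: measure0|by move=> A; exact: measure_ge0
  |exact: measure_semi_sigma_additive|].
have /sigma_finiteP[F [TF ndF Foo]] := sigma_finiteT leb.
have /sigma_finiteP[G [TG ndG Goo]] := sigma_finiteT m.
exists (fun k => @split_rV n @^-1` (F k `*` G k)).
  rewrite -preimage_bigcup predeqE => y; split=> // _ /=.
  have [i _ Fi] : (\bigcup_i F i) (split_rV y).1 by rewrite -TF.
  have [j _ Gj] : (\bigcup_i G i) (split_rV y).2 by rewrite -TG.
  exists (maxn i j) => //; split=> /=.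
    by move: Fi; exact/subsetPset/ndF/leq_maxl.
  by move: Gj; exact/subsetPset/ndG/leq_maxr.
move=> k; have [mF Fk] := Foo k; have [mG Gk] := Goo k; split.
  rewrite -[X in measurable X]setTI.
  by apply: measurable_split_rV => //; exact: measurableX.
rewrite /M /= /pushforward -comp_preimage (_ : _ \o f = id); last first.
  by apply/funext => z; exact: split_rVK.
rewrite [ltLHS](_ : _ = leb (F k) * m (G k)); last (have := @product_measure1E _ _ (measurableTypeR R) _ R leb m (F k) (G k) mF mG; exact).
by rewrite lte_mul_pinfty// ge0_fin_numE.
Qed.

Let lebesgue_rV0 n : lebesgue_rV (set0 : set 'rV[R]_n) = 0.
Proof. by have [] := lebesgue_rV_prop n. Qed.

Let lebesgue_rV_ge0 n (A : set 'rV[R]_n) : 0 <= lebesgue_rV A.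
Proof. by have [] := lebesgue_rV_prop n. Qed.

Let lebesgue_rV_sigma_additive n : semi_sigma_additive (@lebesgue_rV n).
Proof. by have [] := lebesgue_rV_prop n. Qed.

HB.instance Definition _ n := isMeasure.Build _ _ _ (@lebesgue_rV n)
  (@lebesgue_rV0 n) (@lebesgue_rV_ge0 n) (@lebesgue_rV_sigma_additive n).

Let lebesgue_rV_sigma_finite n : sigma_finite setT (@lebesgue_rV n).
Proof. by have [] := lebesgue_rV_prop n. Qed.

HB.instance Definition _ n := Measure_isSigmaFinite.Build _ _ _ (@lebesgue_rV n)
  (@lebesgue_rV_sigma_finite n).

End lebesgue_rV.


Section euclidean.
Variables (R : realType) (d : nat).
Implicit Types x y : 'rV[R]_d.

Definition dotr x y : R := (x *m y^T) ord0 ord0.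

Definition enorm x : R := Num.sqrt (dotr x x).

Lemma measurable_enorm : measurable_fun setT enorm.
Proof.
apply: measurableT_comp.
  by apply: continuous_measurable_fun; exact: sqrt_continuous.
rewrite (_ : (fun x => _) = fun x => \sum_i (x ord0 i * x ord0 i)); last first.
  by apply/funext => x; rewrite /dotr mxE; apply: eq_bigr => i _; rewrite mxE.
apply: measurable_sum => i.
by apply: measurable_funM; exact: measurable_coord.
Qed.

Definition unit_ball_punctured : set 'rV[R]_d := [set y | 0 < enorm y <= 1].

Lemma measurable_unit_ball_punctured : measurable unit_ball_punctured.
Proof.
rewrite (_ : unit_ball_punctured = enorm @^-1` `]0, 1]); last first.
  by apply/seteqP; split => y /=; rewrite in_itv.
by rewrite -[X in measurable X]setTI; apply: measurable_enorm.
Qed.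

Lemma measurable_radial :
  measurable_fun [set: R * 'rV[R]_d] (fun z => (z.1 / enorm z.2) *: z.2).
Proof.
apply: measurable_fun_rV => i.
rewrite (_ : (fun z => _) =
    fun z => (z.1 * powR (enorm z.2) (-1)) * z.2 ord0 i); last first.
  by apply/funext => z; rewrite mxE powR_inv1// sqrtr_ge0.
apply: measurable_funM; last first.
  by apply: (measurableT_comp (@measurable_coord _ R d i)).
apply: measurable_funM => //.
apply: (measurableT_comp (measurable_powR _)).
by apply: (measurableT_comp measurable_enorm).
Qed.

(* Surface measure of the sphere of radius r in R^d, by the cone formula
   omega_r(A) = d r^(d-1) |{y : 0 < |y| <= 1, r y/|y| in A}|; it is carried by
   the sphere, and it vanishes if r = 0 and d >= 2. *)
Definition sphere_measure (r : R) (A : set 'rV[R]_d) : \bar R :=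
  ((d%:R * `|r| ^+ d.-1)%:E *
   lebesgue_rV [set y | A ((r / enorm y) *: y) /\ (0 < enorm y <= 1)%R])%E.

Section sphere_measure.
Variable r : R.

Let f y := (r / enorm y) *: y.

Let mf : measurable_fun setT f.
Proof.
apply: (measurableT_comp measurable_radial (g := fun y => (r, y))).
apply/measurable_fun_pairP; split.
  exact: (@measurable_cst _ _ _ _ (setT : set ('rV[R]_d)) r).
exact: (@measurable_id _ ('rV[R]_d) setT).
Qed.

Let m : {measure set 'rV[R]_d -> \bar R} :=
  mscale (d%:R * `|r| ^+ d.-1)%:nng
    (measure_function_pushforward__canonical__measure_function_Measure
       (mrestr (@lebesgue_rV R d) measurable_unit_ball_punctured) mf).

Let sphere_measureE : sphere_measure r = m.
Proof. by []. Qed.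

Let sphere_measure0 : sphere_measure r set0 = 0%E.
Proof. by rewrite sphere_measureE measure0. Qed.

Let sphere_measure_ge0 A : (0 <= sphere_measure r A)%E.
Proof. by rewrite sphere_measureE measure_ge0. Qed.

Let sphere_measure_sigma_additive : semi_sigma_additive (sphere_measure r).
Proof. by rewrite sphere_measureE; exact: measure_semi_sigma_additive. Qed.

HB.instance Definition _ := isMeasure.Build _ _ _ (sphere_measure r)
  sphere_measure0 sphere_measure_ge0 sphere_measure_sigma_additive.

End sphere_measure.

Definition heights (vrho : R) : set R :=
  [set t | vrho <= `|t| <= Num.sqrt (vrho ^+ 2 + 1)].

(* d sigma(x,t) = d omega_{sqrt(t^2 - vrho^2)}(x) dt. *)
Definition surface_measure (vrho : R) (A : set ('rV[R]_d * R)) : \bar R :=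
  (\int[lebesgue_measure]_(t in heights vrho)
     sphere_measure (Num.sqrt (t ^+ 2 - vrho ^+ 2)) [set x | A (x, t)])%E.

Section surface_measure.
Variable vrho : R.

Let radius (t : R) := Num.sqrt (t ^+ 2 - vrho ^+ 2).

Let measurable_heights : measurable (heights vrho).
Proof.
rewrite (_ : heights vrho = (@Num.norm _ R : R -> R) @^-1` `[vrho, Num.sqrt (vrho ^+ 2 + 1)]).
  by rewrite -[X in measurable X]setTI; apply: normr_measurable.
by apply/seteqP; split => t /=; rewrite in_itv.
Qed.

Let measurable_radius : measurable_fun setT radius.
Proof.
apply: measurableT_comp.
  by apply: continuous_measurable_fun; exact: sqrt_continuous.
by apply: measurable_funB => //; exact: measurable_funX.
Qed.

Let measurable_section (A : set ('rV[R]_d * R)) : measurable A ->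
  measurable_fun setT (fun t : R => sphere_measure (radius t) [set x | A (x, t)]).
Proof.
move=> mA; apply: emeasurable_funM.
  apply/measurable_EFinP; apply: measurable_funM => //.
  apply: measurable_funX.
  exact: (measurableT_comp (@normr_measurable R setT) measurable_radius).
pose g (z : R * 'rV[R]_d) := ((radius z.1 / enorm z.2) *: z.2, z.1).
have mg : measurable_fun setT g.
  apply/measurable_fun_pairP; split; last exact: measurable_fst.
  apply: (measurableT_comp measurable_radial
    (g := fun z : R * 'rV[R]_d => (radius z.1, z.2))).
  apply/measurable_fun_pairP; split; last exact: measurable_snd.
  exact: (measurableT_comp measurable_radius measurable_fst).
have mB : measurable (g @^-1` A `&` ([set: R] `*` unit_ball_punctured)).
  apply: measurableI.
    by rewrite -[X in measurable X]setTI; exact: mg.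
  by apply: measurableX => //; exact: measurable_unit_ball_punctured.
have := measurable_fun_xsection (@lebesgue_rV R d) mB.
apply: eq_measurable_fun => t _ /=.
congr lebesgue_rV; apply/seteqP; split => y /=; rewrite /xsection/= inE/=.
  by move=> [? [_ ?]].
by move=> [].
Qed.

Let surface_measure0 : surface_measure vrho set0 = 0%E.
Proof. by rewrite /surface_measure integral0_eq// => t _; exact: measure0. Qed.

Let surface_measure_ge0 A : (0 <= surface_measure vrho A)%E.
Proof. by apply: integral_ge0 => t _; exact: measure_ge0. Qed.

Let surface_measure_sigma_additive : semi_sigma_additive (surface_measure vrho).
Proof.
move=> F mF tF mUF.
rewrite [X in _ --> X](_ : _ = (\sum_(n <oo) surface_measure vrho (F n))%E).
  by apply/cvg_closeP; split; [apply: is_cvg_nneseries|rewrite closeE].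
rewrite -integral_nneseries//; last first.
  by move=> n; apply: measurable_funTS; exact: (measurable_section (mF n)).
apply: eq_integral => t _; apply/esym/cvg_lim => //=.
rewrite (_ : [set x | _] = \bigcup_n [set x | F n (x, t)]) //.
apply: (@measure_sigma_additive _ _ _ (sphere_measure (radius t))).
  move=> n; have := measurable_ysection t (mF n).
  by congr measurable; apply/seteqP; split => x; rewrite /ysection/= inE.
apply/trivIsetP => i j _ _ ij; apply/seteqP; split => // x [Fi Fj].
move/trivIsetP : tF => /(_ i j Logic.I Logic.I ij) Fij0.
by have : (F i `&` F j) (x, t) by []; rewrite Fij0.
Qed.

HB.instance Definition _ := isMeasure.Build _ _ _ (surface_measure vrho)
  surface_measure0 surface_measure_ge0 surface_measure_sigma_additive.

End surface_measure.
End euclidean.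

(* The notations of mpoly clash with those of mathcomp-analysis. *)
From mathcomp Require Import -(notations) mpoly.

Section conic_surface.
Variables (R : realType) (d : nat) (vrho : R).
Implicit Types (y z : 'rV[R]_d * R) (f w : 'rV[R]_d * R -> R).
Implicit Types (Xi : set ('rV[R]_d * R)).

Definition conic : set ('rV[R]_d * R) :=
  [set z | enorm z.1 ^+ 2 = z.2 ^+ 2 - vrho ^+ 2 /\ heights vrho z.2].

(* When vrho > 0 the distance is only meaningful for two points of the same
   part; this predicate guards every use of [conic_dist]. When vrho = 0 there
   is no restriction, and [conic_dist] does not separate (x,t) from (x,-t). *)
Definition same_part y z : Prop :=
  [\/ vrho = 0, 0 <= y.2 /\ 0 <= z.2 | y.2 <= 0 /\ z.2 <= 0].

Definition conic_dist y z : R :=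
  acos (dotr y.1 z.1 + Num.sqrt (1 + vrho ^+ 2 - y.2 ^+ 2) *
                       Num.sqrt (1 + vrho ^+ 2 - z.2 ^+ 2)).

Definition conic_ball z (r : R) : set ('rV[R]_d * R) :=
  [set y | [/\ conic y, same_part z y & conic_dist z y <= r]].

Definition weight w : Prop :=
  measurable_fun conic w /\ forall z, conic z -> 0 <= w z.

Definition even_on_conic f : Prop :=
  forall x t, conic (x, t) -> f (x, t) = f (x, - t).

Definition weighted_measure w (E : set ('rV[R]_d * R)) : \bar R :=
  (\int[surface_measure vrho]_(z in E) (w z)%:E)%E.

Definition weighted_norm (p : R) w f : \bar R :=
  ((\int[surface_measure vrho]_(z in conic) (`|f z| `^ p * w z)%:E) `^ p^-1)%E.

(* No upper bound on r: every ball lies in the surface, and for r at least the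
   diameter the inequality only says that L >= 1. *)
Definition doubling_bound w (L : R) : Prop :=
  0 < L /\ forall z r, conic z -> 0 < r ->
    (weighted_measure w (conic_ball z (2 * r)) <=
     L%:E * weighted_measure w (conic_ball z r))%E.

Definition doubling w : Prop := exists L, doubling_bound w L.

Definition doubling_constant w : R := inf [set L | doubling_bound w L].

(* [msize] is the total degree plus one; the last variable is t. *)
Definition even_polynomials (n : nat) : set ('rV[R]_d * R -> R) :=
  [set f | (exists P : mpoly (d + 1) R,
      (msize P <= n.+1)%N /\
      forall z, conic z ->
        f z = meval (row_mx z.1 (z.2%:M : 'rV_1) ord0) P) /\
    even_on_conic f].

Definition separated (eps : R) Xi : Prop :=
  forall y z, Xi y -> Xi z -> y <> z -> same_part y z -> eps <= conic_dist y z.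

Definition maximal (eps : R) Xi : Prop :=
  exists2 c : R, 1 < c & forall y, conic y ->
    (1 <= \esum_(z in Xi) (\1_(conic_ball z eps) y : R)%:E <= c%:E)%E.

Definition symmetric Xi : Prop :=
  ~ Xi (0, 0) /\
  [set z | Xi z /\ z.2 < 0] = [set (- z.1, - z.2) | z in [set z | Xi z /\ 0 < z.2]].

Definition symmetric_maximal_separated (eps : R) Xi : Prop :=
  [/\ Xi `<=` conic, separated eps Xi, maximal eps Xi & symmetric Xi].

End conic_surface.

(* Main.v *)
Require Import Defs.
From mathcomp Require Import all_boot all_order all_algebra.
From mathcomp Require Import all_classical all_reals all_analysis.
From mathcomp Require Import measurable_realfun ring lra zify.
From mathcomp Require Import -(notations) mpoly.
Import Order.TTheory GRing.Theory Num.Theory.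
Import numFieldNormedType.Exports.
Local Open Scope classical_set_scope.
Local Open Scope ring_scope.
Set Implicit Arguments.
Unset Strict Implicit.
Unset Printing Implicit Defensive.

(** On the surface t ^ 2 = |x| ^ 2 + vrho ^ 2, so that a polynomial even in t
    is there a polynomial q in x alone, and (x, t) |-> (x, s) with
    s = sqrt (1 + vrho ^ 2 - t ^ 2) sends each part of the surface to the closed
    upper half of the unit sphere of R^(d + 1), turning [conic_dist] into the
    geodesic distance.  Along a great circle x is a combination of cosine and
    sine, so q becomes a trigonometric polynomial of the same degree.  Great
    circles that leave the upper hemisphere do no harm: reflecting the last
    coordinate does not change q and brings points closer to the centre.

    What the proof needs of polynomials is therefore essentially
    one-dimensional, a localized form of Bernstein's inequality
    ([local_bernstein]): if a trigonometric polynomial T of degree O(n) is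
    bounded by A (1 + n |y|) ^ B on the circle, then
    |T x - T 0| <= C n |x| A for |x| <= 1 / n.  It follows from Bernstein's
    inequality for the product of T and the B-th power of the Dirichlet kernel,
    which equals 1 at 0 and absorbs the growth.  On the surface this reads
    |f u - f y| <= C n d(y, u) f* y for d(y, u) <= 1 / n
    ([conic_local_bernstein]), where
    f* y = sup_v |f v| / (1 + n d(y, v)) ^ B ([fstar]).

    From there on the argument takes place in an arbitrary doubling
    pseudometric space.  As f* varies slowly, the inequality above forces |f| to
    be of the order of f* x (1 + n d(x, v)) ^ B on a whole ball of radius
    comparable to 1 / n around some point v ([fstar_attained]).  Averaging
    |f| ^ p over that ball and comparing its mass with that of a dyadic ball
    centred at x bounds f* x ^ p by averages of |f| ^ p over dyadic balls, with
    geometrically decreasing weights once 2 ^ (B p) >= 2 L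
    ([fstar_pow_le]).  Summing over a separated set, where packing and doubling
    control the overlaps ([sum_ratio_le]), yields
    sum_z f* z ^ p w(B_z) <= C ^ p int |f| ^ p w ([sum_fstar_le]).

    Part (i) follows, since max |f| over B_z is at most 2 ^ B f* z.  For part
    (ii), |f| oscillates on B_z by at most 2 C delta f* z, so that
    int |f| ^ p w <= 2 ^ p sum_z min |f| ^ p w(B_z) + 1 / 2 int |f| ^ p w for
    small delta.  A doubling weight may give mass 0 or +oo to a part of the
    surface, and then it does so to all balls of that part; in the second case
    int |f| ^ p w and, for small delta, the sum of the minima are infinite unless
    f vanishes on that part. *)

(** * Trigonometric polynomials and Bernstein's inequality *)

Section trigonometric_polynomials.
Variable R : realType.
Implicit Types (f g : R -> R) (a b x : R) (N : nat).

(** A term (a, m, b) of the list stands for a cos (m x + b): with arbitrary phases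
    the sines need no separate treatment, and products stay in the span by the
    addition formula. *)
Definition trig_sum (s : seq (R * nat * R)) (x : R) : R :=
  \sum_(h <- s) h.1.1 * cos (h.1.2%:R * x + h.2).

Definition trigpoly N f : Prop :=
  exists2 s, all (fun h => (h.1.2 <= N)%N) s & f =1 trig_sum s.

Lemma eq_trigpoly N f g : f =1 g -> trigpoly N f -> trigpoly N g.
Proof. by move=> fg [s sN fE]; exists s => // x; rewrite -fg. Qed.

Lemma trigpoly_le N M f : (N <= M)%N -> trigpoly N f -> trigpoly M f.
Proof.
move=> NM [s sN fE]; exists s => //.
by apply: sub_all sN => h /leq_trans; apply.
Qed.

Lemma trigpoly_cos N m b : (m <= N)%N ->
  trigpoly N (fun x => cos (m%:R * x + b)).
Proof.
move=> mN; exists [:: (1, m, b)]; first by rewrite /= mN.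
by move=> x; rewrite /trig_sum big_seq1/= mul1r.
Qed.

Lemma trigpolyD N f g : trigpoly N f -> trigpoly N g ->
  trigpoly N (fun x => f x + g x).
Proof.
move=> [s sN fE] [t tN gE]; exists (s ++ t); first by rewrite all_cat sN.
by move=> x; rewrite fE gE /trig_sum big_cat.
Qed.

Lemma trigpoly0 N : trigpoly N (fun=> 0).
Proof. by exists [::] => // x; rewrite /trig_sum big_nil. Qed.

Lemma trigpolyZ N a f : trigpoly N f -> trigpoly N (fun x => a * f x).
Proof.
move=> [s sN fE]; exists [seq (a * h.1.1, h.1.2, h.2) | h <- s].
  by rewrite all_map; apply: sub_all sN => -[[]].
move=> x; rewrite fE /trig_sum big_map mulr_sumr.
by apply: eq_bigr => h _; rewrite mulrA.
Qed.

Lemma trigpoly_sum N (I : Type) (r : seq I) (F : I -> R -> R) :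
  (forall i, trigpoly N (F i)) -> trigpoly N (fun x => \sum_(i <- r) F i x).
Proof.
move=> FN; elim: r => [|i r IH].
  by apply: eq_trigpoly (trigpoly0 N) => x; rewrite big_nil.
apply: eq_trigpoly (trigpolyD (FN i) IH) => x; by rewrite big_cons.
Qed.

Lemma trigpolyC N a : trigpoly N (fun=> a).
Proof.
apply: eq_trigpoly (trigpolyZ a (@trigpoly_cos N 0 0 (leq0n _))) => x.
by rewrite mul0r addr0 cos0 mulr1.
Qed.

Lemma cosM_cos a b : cos a * cos b = 2^-1 * cos (a + b) + 2^-1 * cos (a - b) :> R.
Proof. by rewrite cosD cosB; field. Qed.

Lemma trigpoly_cosM N M m k b c : (m <= N)%N -> (k <= M)%N ->
  trigpoly (N + M) (fun x => cos (m%:R * x + b) * cos (k%:R * x + c)).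
Proof.
move=> mN kM.
have mk : (m + k <= N + M)%N by exact: leq_add.
have H1 := trigpolyZ 2^-1 (trigpoly_cos (b + c) mk).
have [km|/ltnW mk'] := leqP k m.
  have mk2 : (m - k <= N + M)%N by lia.
  have H2 := trigpolyZ 2^-1 (trigpoly_cos (b - c) mk2).
  apply: eq_trigpoly (trigpolyD H1 H2) => x.
  rewrite cosM_cos; congr (_ * cos _ + _ * cos _); first by rewrite natrD; ring.
  by rewrite natrB//; ring.
have mk2 : (k - m <= N + M)%N by lia.
have H2 := trigpolyZ 2^-1 (trigpoly_cos (c - b) mk2).
apply: eq_trigpoly (trigpolyD H1 H2) => x.
rewrite cosM_cos; congr (_ * cos _ + _ * _); first by rewrite natrD; ring.
by rewrite -cosN; congr cos; rewrite natrB//; ring.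
Qed.

Lemma trigpolyM N M f g : trigpoly N f -> trigpoly M g ->
  trigpoly (N + M) (fun x => f x * g x).
Proof.
move=> [s sN fE] [t tM gE].
have {}fE : f = trig_sum s by apply/funext.
have {}gE : g = trig_sum t by apply/funext.
subst f g.
elim: s sN => [_|h s IH /= /andP[hN /IH sN]].
  by apply: eq_trigpoly (trigpoly0 _) => x; rewrite /trig_sum big_nil mul0r.
suff H : trigpoly (N + M)
    (fun x => h.1.1 * cos (h.1.2%:R * x + h.2) * trig_sum t x).
  apply: eq_trigpoly (trigpolyD H sN) => x.
  by rewrite /trig_sum [in RHS]big_cons mulrDl.
elim: t tM {IH sN} => [_|k t IH /= /andP[kM /IH tM]].
  by apply: eq_trigpoly (trigpoly0 _) => x; rewrite /trig_sum big_nil mulr0.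
have H := trigpolyZ (h.1.1 * k.1.1) (trigpoly_cosM h.2 k.2 hN kM).
apply: eq_trigpoly (trigpolyD H tM) => x.
by rewrite /trig_sum [in RHS]big_cons; ring.
Qed.

Lemma trigpolyX N f k : trigpoly N f -> trigpoly (k * N) (fun x => f x ^+ k).
Proof.
move=> fN; elim: k => [|k IH].
  by apply: eq_trigpoly (trigpolyC _ 1) => x; rewrite expr0.
rewrite mulSn; apply: eq_trigpoly (trigpolyM fN IH) => x; by rewrite exprS.
Qed.

Lemma trigpoly_prod (I : Type) (r : seq I) (F : I -> R -> R) (N : I -> nat) :
  (forall i, trigpoly (N i) (F i)) ->
  trigpoly (\sum_(i <- r) N i)%N (fun x => \prod_(i <- r) F i x).
Proof.
move=> FN; elim: r => [|i r IH].
  rewrite big_nil; apply: eq_trigpoly (trigpolyC _ 1) => x.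
  by rewrite big_nil.
rewrite big_cons; apply: eq_trigpoly (trigpolyM (FN i) IH) => x.
by rewrite big_cons.
Qed.

Lemma trigpoly_linear a b : trigpoly 1 (fun x => a * cos x + b * sin x).
Proof.
have H1 := trigpolyZ a (@trigpoly_cos 1 1 0 (leqnn _)).
have H2 := trigpolyZ b (@trigpoly_cos 1 1 (- (pi / 2)) (leqnn _)).
apply: eq_trigpoly (trigpolyD H1 H2) => x.
by rewrite !mul1r addr0 cosBpihalf.
Qed.

Lemma cosD2pin a k : cos (a + k%:R * (pi *+ 2)) = cos a :> R.
Proof. by rewrite mulr_natl (periodicn (@cosD2pi R)). Qed.

(** M. Riesz's interpolation formula expresses f' x, for f of degree at most N, as
    a combination of the values of f at the 2 N points x + (2 k + 1) pi / (2 N),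
    with coefficients of alternating signs.  The inequality of Bernstein needs
    only that the sum of their absolute values is N, which is forced by the
    formula itself for the frequency N; so the coefficients are only determined
    up to a common factor, as [mass]. *)
Section riesz.
Variable N : nat.
Hypothesis N_gt0 : (0 < N)%N.

Let N_neq0 : (N%:R : R) != 0.
Proof. by rewrite pnatr_eq0 -lt0n. Qed.

Let node (k : nat) : R := (k.*2.+1)%:R * pi / (N.*2)%:R.
Let mass (k : nat) : R := (sin (node k / 2) ^+ 2)^-1.

Let natr_double : (N.*2)%:R = N%:R * 2 :> R.
Proof. by rewrite -muln2 natrM. Qed.

Let nodeE k : node k = (k%:R * 2 + 1) * pi / (N%:R * 2).
Proof. by rewrite /node -!muln2 -addn1 natrD !natrM. Qed.

Let sin_node k : (k < N.*2)%N -> 0 < sin (node k / 2).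
Proof.
move=> kN; apply: sin_gt0_pi; have pi0 := @pi_gt0 R.
have N0 : (0 : R) < (N.*2)%:R by rewrite ltr0n double_gt0.
rewrite /node; apply/andP; split.
  by rewrite divr_gt0// divr_gt0// mulr_gt0.
rewrite ltr_pdivrMr// ltr_pdivrMr// -mulrA mulrC ltr_pM2l//.
rewrite -[2]/(2%:R) -natrM ltr_nat; lia.
Qed.

(* Multiplication by 2 cos (m pi / (2 N)), which does not vanish for |m| < N,
   makes the sum telescope; the frequency is written m = i - N. *)
Let alternating_sum a i : (0 < i < N.*2)%N ->
  \sum_(k < N.*2) (-1) ^+ k * cos (a + (i%:R - N%:R) * node k) = 0 :> R.
Proof.
move=> /andP[i0 iN].
pose m : R := i%:R - N%:R.
pose c k : R := (-1) ^+ k * cos (a + m * ((k%:R * pi) / N%:R)).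
have cosm : cos (m * (pi / N.*2%:R)) != 0.
  apply: lt0r_neq0; apply: cos_gt0_pihalf.
  have pi0 := @pi_gt0 R.
  have N0 : (0 : R) < N%:R by rewrite ltr0n.
  have -> : pi / (N.*2)%:R = pi / 2 / N%:R :> R.
    by rewrite -muln2 natrM; field.
  have : - N%:R < m < N%:R.
    have : (i%:R : R) < (N.*2)%:R by rewrite ltr_nat.
    have : (0 : R) < i%:R by rewrite ltr0n.
    by rewrite -muln2 natrM /m; lra.
  move=> /andP[m1 m2]; rewrite mulrA; set q := pi / 2.
  have q0 : 0 < q by rewrite divr_gt0.
  rewrite ltr_pdivlMr// ltr_pdivrMr// mulNr -mulrN ![_ * q]mulrC.
  by rewrite !ltr_pM2l// m1.
have cosm2 : 2 * cos (m * (pi / N.*2%:R)) != 0 by rewrite mulf_neq0// pnatr_eq0.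
apply: (mulfI cosm2).
rewrite mulr0 mulr_sumr.
have -> : \sum_(k < N.*2) 2 * cos (m * (pi / N.*2%:R)) *
    ((-1) ^+ k * cos (a + (i%:R - N%:R) * node k)) =
    \sum_(k < N.*2) (- (c k.+1 - c k)).
  apply: eq_bigr => k _; rewrite -/m.
  have -> : 2 * cos (m * (pi / N.*2%:R)) *
      ((-1) ^+ k * cos (a + m * node k)) =
      2 * ((-1) ^+ k * (cos (a + m * node k) * cos (m * (pi / N.*2%:R)))).
    by ring.
  rewrite cosM_cos /c exprS.
  have -> : a + m * node k + m * (pi / N.*2%:R) = a + m * (k.+1%:R * pi / N%:R).
    rewrite nodeE natr_double -[k.+1]addn1 natrD; field.
    exact: N_neq0.
  have -> : a + m * node k - m * (pi / N.*2%:R) = a + m * (k%:R * pi / N%:R).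
    rewrite nodeE natr_double; field.
    exact: N_neq0.
  by field.
rewrite sumrN -(big_mkord xpredT (fun k => c k.+1 - c k)) telescope_sumr//.
rewrite /c expr0 mul0r mul0r mulr0 addr0 -mul2n exprM sqrrN !expr1n !mul1r.
have -> : m * ((2 * N)%:R * pi / N%:R) = i%:R * (pi *+ 2) - N%:R * (pi *+ 2).
  by rewrite natrM /m -mulr_natr; field.
rewrite -[X in - (X - _)](cosD2pin _ N) -addrA subrK.
by rewrite cosD2pin subrr oppr0.
Qed.

Let mass_sum : R := \sum_(k < N.*2) mass k.

Let mass_ge0 k : 0 <= mass k.
Proof. by rewrite invr_ge0 sqr_ge0. Qed.

Let mass_sum_gt0 : 0 < mass_sum.
Proof.
have h : (0 < N.*2)%N by rewrite double_gt0.
rewrite /mass_sum (bigD1 (Ordinal h))//= ltr_pwDl//.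
  by rewrite invr_gt0 exprn_gt0// sin_node.
by apply: sumr_ge0 => k _; exact: mass_ge0.
Qed.

(* As a function of the frequency i - N, this has second difference
   -4 sin (node / 2) ^ 2 times the summand, and the square cancels [mass]: the
   second difference is an alternating sum, hence zero, and G is affine in i.
   Since G takes opposite values at i = 0 and i = 2 N, it is then proportional
   to the frequency. *)
Let G a i : R :=
  \sum_(k < N.*2) (-1) ^+ k * mass k * cos (a + (i%:R - N%:R) * node k).

Let G_affine a i : (i <= N.*2)%N -> G a i = G a 0 + i%:R * (G a 1 - G a 0).
Proof.
have second i' : (0 < i' < N.*2)%N -> G a i'.+1 = 2 * G a i' - G a i'.-1.
  case: i' => // i' /[dup] /andP[_ iN] H.
  apply/eqP; rewrite -subr_eq0 /= /G mulr_sumr.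
  apply/eqP; transitivity (- 4 * (\sum_(k < N.*2) (-1) ^+ k *
      cos (a + (i'.+1%:R - N%:R) * node k))); last first.
    by rewrite alternating_sum// mulr0.
  rewrite -!sumrB mulr_sumr.
  apply: eq_bigr => k _.
  set m := i'.+1%:R - N%:R.
  have -> : a + (i'.+2%:R - N%:R) * node k = (a + m * node k) + node k.
    by rewrite /m -[i'.+2]addn1 natrD; ring.
  have -> : a + (i'%:R - N%:R) * node k = (a + m * node k) - node k.
    by rewrite /m -[i'.+1]addn1 natrD; ring.
  have -> : cos (a + m * node k + node k) = 2 * (cos (a + m * node k) *
      cos (node k)) - cos (a + m * node k - node k).
    by rewrite cosD cosB; ring.
  have -> : cos (node k) = 1 - 2 * sin (node k / 2) ^+ 2.
    have {1}-> : node k = (node k / 2) *+ 2 by rewrite mulr2n; field.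
    by rewrite cos_mulr2n cos2sin2 mulr2n; ring.
  rewrite /mass; field; apply/lt0r_neq0; exact: sin_node.
have := ltnSn i; move: {2}i.+1 => n; elim: n i => // n IH [|[|i]] lin iN.
- by rewrite mul0r addr0.
- by rewrite mul1r addrC subrK.
rewrite second//=.
rewrite (IH i.+1); [|lia|lia]; rewrite (IH i); [|lia|lia].
rewrite -[i.+2]addn2 -[i.+1]addn1 !natrD; ring.
Qed.

Lemma riesz_cos a m : (m <= N)%N ->
  \sum_(k < N.*2) (-1) ^+ k * mass k * cos (a + m%:R * node k) =
  - (m%:R / N%:R * mass_sum * sin a).
Proof.
move=> mN.
have endpoint s (x : R) : x = s * N%:R -> (s = 1 \/ s = -1) ->
    \sum_(k < N.*2) (-1) ^+ k * mass k * cos (a + x * node k) =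
    - s * sin a * mass_sum.
  move=> -> s1; rewrite mulr_sumr; apply: eq_bigr => k _.
  have -> : s * N%:R * node k = s * (k%:R * pi + pi / 2).
    by rewrite nodeE; field.
  have cN (b : R) : cos (b + pi / 2) = - sin b by rewrite cosDpihalf.
  have c0 : cos (k%:R * pi + pi / 2) = 0 :> R.
    elim: (k : nat) => [|j IH]; first by rewrite mul0r add0r cos_pihalf.
    rewrite -[j.+1]addn1 natrD mulrDl mul1r addrAC cosDpi IH oppr0//.
  have s0 : sin (k%:R * pi + pi / 2) = (-1) ^+ k :> R.
    elim: (k : nat) => [|j IH]; first by rewrite mul0r add0r sin_pihalf.
    rewrite -[j.+1]addn1 natrD mulrDl mul1r addrAC sinDpi IH.
    by rewrite addn1 exprS mulN1r.
  have sg2 : (-1) ^+ k * (-1) ^+ k = 1 :> R.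
    by rewrite -exprD addnn -mul2n exprM sqrrN expr1n expr1n.
  by case: s1 => ->; [rewrite mul1r cosD|rewrite mulN1r cosB]; rewrite c0 s0;
    ring: sg2.
have GE i : \sum_(k < N.*2) (-1) ^+ k * mass k * cos (a + (i%:R - N%:R) * node k)
   = G a i by [].
have G0 : G a 0 = sin a * mass_sum.
  rewrite -GE (endpoint (-1)); [by ring|by ring|by right].
have G2N : G a N.*2 = - (sin a * mass_sum).
  rewrite -GE (endpoint 1); [by ring| |by left].
  by rewrite -mul2n natrM; ring.
have Gm : G a (N + m) = G a 0 + (N + m)%:R * (G a 1 - G a 0).
  by apply: G_affine; lia.
have := G_affine a (leqnn N.*2); rewrite G2N G0 => G1.
have {}G1 : G a 1 - sin a * mass_sum = - (sin a * mass_sum) / N%:R.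
  apply: (mulfI N_neq0); rewrite mulrCA mulfV// mulr1.
  have : (N.*2)%:R = 2 * N%:R :> R by rewrite -mul2n natrM.
  by move: G1 => /[swap] ->; lra.
move: Gm; rewrite G0 G1 -GE natrD [_ + m%:R]addrC addrK => ->.
by field.
Qed.

Lemma is_derive_cos_affine (m b x : R) :
  is_derive x 1 (fun y => cos (m * y + b)) (- (m * sin (m * x + b))).
Proof. by apply: is_derive_eq; rewrite /GRing.scale /=; ring. Qed.

(** By [riesz_cos], f' is N / mass_sum times a combination of values of f whose
    coefficients have absolute values of sum mass_sum. *)
Lemma bernstein f M : trigpoly N f -> (forall x, `|f x| <= M) ->
  forall x, `|f x - f 0| <= N%:R * `|x| * M.
Proof.
move=> [s sN fE] fM.
pose f' x := \sum_(h <- s) h.1.1 * (- (h.1.2%:R * sin (h.1.2%:R * x + h.2))).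
have df x : is_derive x (1 : R) f (f' x).
  have -> : f = (fun x => trig_sum s x) by apply/funext.
  rewrite /trig_sum /f' {f'}; clear sN fE; elim: s => [|h s IH].
    rewrite big_nil; under eq_fun do rewrite big_nil.
    exact: is_derive_cst.
  rewrite big_cons; under eq_fun do rewrite big_cons.
  exact: (@is_deriveD _ _ _ (h.1.1 \*: (fun y => cos (h.1.2%:R * y + h.2))) _ _ _
    _ _ (is_deriveZ _ (is_derive_cos_affine _ _ _)) IH).
have f'E x : f' x = N%:R / mass_sum *
    \sum_(k < N.*2) (-1) ^+ k * mass k * f (x + node k).
  under eq_bigr => k _ do rewrite fE /trig_sum mulr_sumr.
  rewrite exchange_big /= mulr_sumr /f' [in LHS]big_seq [in RHS]big_seq.
  apply: eq_bigr => h hs.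
  have hN : (h.1.2 <= N)%N by move/allP : sN => /(_ _ hs).
  transitivity (N%:R / mass_sum * (h.1.1 * (\sum_(k < N.*2) (-1) ^+ k * mass k *
     cos ((h.1.2%:R * x + h.2) + h.1.2%:R * node k)))).
    rewrite riesz_cos//; field.
    by rewrite N_neq0 gt_eqF.
  congr (_ * _); rewrite mulr_sumr; apply: eq_bigr => k _.
  rewrite mulrCA; congr (_ * (_ * cos _)); ring.
have f'M x : `|f' x| <= N%:R * M.
  have L0 := mass_sum_gt0.
  rewrite f'E normrM ger0_norm; last by rewrite divr_ge0// ltW.
  rewrite [leRHS](_ : _ = N%:R / mass_sum * (M * mass_sum)); last first.
    by field; rewrite gt_eqF.
  apply: ler_wpM2l; first by rewrite divr_ge0// ltW.
  apply: le_trans (ler_norm_sum _ _ _) _.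
  rewrite /mass_sum mulr_sumr; apply: ler_sum => k _.
  rewrite !normrM normrX normrN1 expr1n mul1r (ger0_norm (mass_ge0 k)) mulrC.
  exact: ler_wpM2r.
have lip x y : x <= y -> `|f y - f x| <= N%:R * (y - x) * M.
  move=> xy.
  have [c _ ->] := MVT_segment xy (fun z _ => df z)
    (derivable_within_continuous (fun z _ => @ex_derive _ _ _ _ _ _ _ (df z))).
  rewrite normrM (ger0_norm (_ : 0 <= y - x)) ?subr_ge0// mulrAC.
  by apply: ler_wpM2r; rewrite ?subr_ge0.
move=> x; have [x0|/ltW x0] := leP 0 x.
  by rewrite (ger0_norm x0) -{2}[x]subr0; exact: lip.
by rewrite (ler0_norm x0) distrC -[- x]add0r; exact: lip.
Qed.

End riesz.

Lemma acos_cos_ge0 x : 0 <= acos (cos x).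
Proof. by rewrite acos_ge0// cos_geN1 cos_le1. Qed.

Lemma acos_cos_le_norm x : acos (cos x) <= `|x|.
Proof.
have [xpi|/ltW pix] := leP `|x| pi.
  by rewrite -cos_norm cosK// in_itv/= normr_ge0.
by apply: le_trans pix; rewrite acos_lepi// cos_geN1 cos_le1.
Qed.

(** sin y >= y cos y, applied to y = x / 2, gives sin x >= x cos (x / 2) ^ 2, and
    cos (x / 2) ^ 2 = (1 + cos x) / 2. *)
Lemma half_le_sin x : 0 <= x <= pi / 2 -> x / 2 <= sin x.
Proof.
move=> /andP[x0 xpi].
set y := x / 2; have y0 : 0 <= y by rewrite divr_ge0.
have xE : x = y *+ 2 by rewrite mulr2n /y; field.
have pi0 := @pi_gt0 R.
have dsin z : is_derive z (1 : R) (fun z => sin z - z * cos z) (z * sin z).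
  by apply: is_derive_eq; rewrite /GRing.scale /=; ring.
have [c cy H] := MVT_segment y0 (fun z _ => dsin z)
  (derivable_within_continuous (fun z _ => @ex_derive _ _ _ _ _ _ _ (dsin z))).
have siny : y * cos y <= sin y.
  rewrite -subr_ge0; move: H; rewrite sin0 mul0r !subr0 => ->.
  move: cy; rewrite in_itv/= => /andP[c0 cy].
  rewrite mulr_ge0// mulr_ge0// sin_ge0_pi// c0/=; apply: le_trans cy _.
  by rewrite /y; lra.
have cosx : 0 <= cos x.
  rewrite cos_ge0_pihalf// xpi andbT; apply: le_trans x0.
  by rewrite oppr_le0 ltW// divr_gt0.
have cosy : 0 <= cos y.
  by rewrite cos_ge0_pihalf//; rewrite /y; apply/andP; split; lra.
move: cosx; rewrite xE sin_mulr2n cos_mulr2n !mulr2n => cosx.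
by nra.
Qed.

(** The Dirichlet kernel, divided by its value at 0. *)
Definition dirichlet n x : R :=
  (1 + 2 * \sum_(j < n) cos (j.+1%:R * x)) / (n.*2.+1)%:R.

Lemma trigpoly_dirichlet n : trigpoly n (dirichlet n).
Proof.
have H : trigpoly n (fun x => \sum_(j < n) cos (j.+1%:R * x)).
  apply: trigpoly_sum => j; apply: eq_trigpoly (trigpoly_cos 0 (ltn_ord j)) => x.
  by rewrite addr0.
have := trigpolyZ (n.*2.+1)%:R^-1 (trigpolyD (trigpolyC n 1) (trigpolyZ 2 H)).
by apply: eq_trigpoly => x; rewrite /dirichlet mulrC.
Qed.

Lemma natr_double1 n : (n.*2.+1)%:R = 1 + 2 * n%:R :> R.
Proof. by rewrite -mul2n -addn1 addnC natrD natrM. Qed.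

Lemma dirichlet0 n : dirichlet n 0 = 1.
Proof.
rewrite /dirichlet; under eq_bigr do rewrite mulr0 cos0.
rewrite sumr_const card_ord natr_double1 -[1 *+ n]/(n%:R) divff//.
Qed.

Lemma dirichlet_le1 n x : `|dirichlet n x| <= 1.
Proof.
rewrite /dirichlet normrM normfV [X in _ / X]ger0_norm// ler_pdivrMr// mul1r.
apply: le_trans (ler_normD _ _) _; rewrite normr1 natr_double1 lerD2l.
rewrite normrM (ger0_norm (ler0n R 2)) ler_pM2l//.
apply: le_trans (ler_norm_sum _ _ _) _.
have -> : n%:R = \sum_(j < n) 1 :> R by rewrite sumr_const card_ord.
by apply: ler_sum => j _; exact: cos_max.
Qed.

Lemma dirichletM n x :
  dirichlet n x * (n.*2.+1)%:R * sin (x / 2) = sin ((n.*2.+1)%:R * (x / 2)).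
Proof.
rewrite /dirichlet divfK ?pnatr_eq0//.
elim: n => [|n IH]; first by rewrite big_ord0 mulr0 addr0 !mul1r.
rewrite big_ord_recr/= mulrDr addrA mulrDl {}IH.
have -> : (n.*2.+1)%:R * (x / 2) = n.+1%:R * x - x / 2.
  by rewrite natr_double1 -[n.+1]addn1 natrD; field.
have -> : (n.+1.*2.+1)%:R * (x / 2) = n.+1%:R * x + x / 2.
  by rewrite natr_double1; field.
by rewrite sinB sinD; ring.
Qed.

(** [acos (cos x)] is the distance from x to the nearest multiple of 2 pi. *)
Lemma dirichlet_decay n x : (1 + n%:R * acos (cos x)) * `|dirichlet n x| <= 3.
Proof.
set y := acos (cos x); have y0 : 0 <= y := acos_cos_ge0 x.
have ypi : y <= pi by rewrite acos_lepi// cos_geN1 cos_le1.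
have cosy : cos y = cos x by rewrite acosK// in_itv/= cos_geN1 cos_le1.
have half z : sin (z / 2) ^+ 2 = (1 - cos z) / 2 :> R.
  have {2}-> : z = (z / 2) *+ 2 by rewrite mulr2n; field.
  by rewrite cos_mulr2n cos2sin2 mulr2n; field.
have sy : y / 4 <= `|sin (x / 2)|.
  rewrite -(@ler_pXn2r _ 2) ?nnegrE ?divr_ge0// -normrX ger0_norm ?sqr_ge0//.
  rewrite half -cosy -half ler_pXn2r ?nnegrE ?divr_ge0//; last first.
    by rewrite sin_ge0_pi// divr_ge0//=; lra.
  have := @half_le_sin (y / 2); rewrite (_ : y / 2 / 2 = y / 4); last by field.
  by apply; rewrite divr_ge0//= ler_pM2r.
have D0 := normr_ge0 (dirichlet n x).
have D1 := dirichlet_le1 n x.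
have : `|dirichlet n x * (n.*2.+1)%:R * sin (x / 2)| <= 1.
  by rewrite dirichletM sin_max.
rewrite normrM (normrM (dirichlet n x)) (ger0_norm (ler0n R _)) natr_double1.
have n0 : (0 : R) <= n%:R by [].
set D := `|dirichlet n x| in D0 D1 *; set s := `|_| in sy * => H.
have : D * n%:R * (y / 4) <= D * n%:R * s by rewrite ler_wpM2l// mulr_ge0.
have : 0 <= D * s by rewrite mulr_ge0// (le_trans _ sy)// divr_ge0.
move: H; set E := D * n%:R.
have -> : D * (1 + 2 * n%:R) * s = D * s + 2 * (E * s) by rewrite /E; ring.
have -> : (1 + n%:R * y) * D = D + E * y by rewrite /E; ring.
have -> : E * (y / 4) = E * y / 4 by rewrite mulrA.
lra.
Qed.

(** Multiplying T by [dirichlet n ^+ B] yields a trigonometric polynomial bounded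
    by 3 ^ B A everywhere, to which [bernstein] applies; the kernel itself moves
    by at most B n |x| from its value 1, while |T x| <= 2 ^ B A. *)
Lemma local_bernstein J n B T A x :
  (0 < n)%N -> (0 < B)%N -> trigpoly (J * n) T -> 0 <= A ->
  (forall y, `|T y| <= A * (1 + n%:R * acos (cos y)) ^+ B) ->
  n%:R * `|x| <= 1 ->
  `|T x - T 0| <= ((J + B)%:R * 3 ^+ B + B%:R * 2 ^+ B) * (n%:R * `|x|) * A.
Proof.
move=> n0 B0 tT A0 TA nx.
have tK : trigpoly (B * n) (fun y => dirichlet n y ^+ B).
  exact/trigpolyX/trigpoly_dirichlet.
have Bn0 : (0 < B * n)%N by rewrite muln_gt0 B0.
have tS := trigpolyM tT tK; rewrite -mulnDl in tS.
have JBn0 : (0 < (J + B) * n)%N by rewrite muln_gt0 addn_gt0 B0 orbT.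
have y0 (y : R) : 0 <= n%:R * acos (cos y).
  exact: mulr_ge0 (ler0n _ _) (acos_cos_ge0 _).
have SM y : `|T y * dirichlet n y ^+ B| <= 3 ^+ B * A.
  rewrite normrM normrX.
  apply: le_trans (ler_wpM2r _ (TA y)) _; first by rewrite exprn_ge0.
  rewrite -mulrA -exprMn mulrC; apply: ler_wpM2r => //.
  rewrite ler_pXn2r ?nnegrE//; first exact: dirichlet_decay.
  by rewrite mulr_ge0// addr_ge0.
have K1 y : `|dirichlet n y ^+ B| <= 1.
  by rewrite normrX exprn_ile1// dirichlet_le1.
have := bernstein JBn0 tS SM x.
have := bernstein Bn0 tK K1 x.
rewrite dirichlet0 expr1n mulr1.
set K := dirichlet n x ^+ B => HK HS.
have Tx : `|T x| <= 2 ^+ B * A.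
  apply: le_trans (TA x) _; rewrite mulrC ler_wpM2r//.
  rewrite ler_pXn2r ?nnegrE ?addr_ge0// -[leRHS]/(1 + 1) lerD2l.
  by apply: le_trans nx; rewrite ler_wpM2l// acos_cos_le_norm.
have -> : T x - T 0 = (T x * K - T 0) + T x * (1 - K) by ring.
apply: le_trans (ler_normD _ _) _; rewrite normrM [`|1 - K|]distrC.
have HK' : `|T x| * `|K - 1| <= 2 ^+ B * A * ((B * n)%:R * `|x| * 1).
  by apply: ler_pM.
apply: le_trans (lerD HS HK') _; rewrite !natrM le_eqVlt; apply/orP; left.
by apply/eqP; ring.
Qed.

End trigonometric_polynomials.

(** * Integrals over families of sets *)

Section integral_families.
Context dd (T : measurableType dd) (R : realType).
Variable mu : {measure set T -> \bar R}.
Implicit Types (F : seq T) (B : T -> set T) (E : set T) (a : T -> R) (g : T -> R).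

Lemma sum_integral_sets F B E a g : measurable E ->
  {in F, forall x, measurable (B x) /\ B x `<=` E} ->
  {in F, forall x, 0 <= a x} ->
  measurable_fun E g -> (forall z, E z -> 0 <= g z) ->
  (\sum_(x <- F) (a x)%:E * \int[mu]_(z in B x) (g z)%:E =
   \int[mu]_(z in E) ((\sum_(x <- F) a x * \1_(B x) z) * g z)%:E)%E.
Proof.
move=> mE FB Fa mg g0.
pose h x z := ((if x \in F then a x * \1_(B x) z else 0) * g z)%:E.
have mh x : measurable_fun E (h x).
  apply/measurable_EFinP; apply: measurable_funM => //.
  case: (boolP (x \in F)) => xF; last exact: measurable_cst.
  apply: measurable_funM => //; apply: measurable_indic.
  by have [] := FB x xF.
have h0 x z : E z -> (0 <= h x z)%E.
  move=> Ez; rewrite lee_fin mulr_ge0 ?g0//; case: ifPn => // xF.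
  by rewrite mulr_ge0 ?Fa.
transitivity (\int[mu]_(z in E) (\sum_(x <- F) h x z))%E.
  rewrite ge0_integral_sum// [in LHS]big_seq [in RHS]big_seq.
  apply: eq_bigr => x xF; have [mB BE] := FB x xF.
  have -> : (\int[mu]_(z in B x) (g z)%:E =
             \int[mu]_(z in E) (\1_(B x) z * g z)%:E)%E.
    rewrite -[in LHS](setIidr BE) integral_mkcondr; apply: eq_integral => z _.
    by rewrite patchE indicE; case: ifP; rewrite ?mul1r ?mul0r.
  rewrite -ge0_integralZl_EFin ?Fa//.
  - by apply: eq_integral => z _; rewrite /h xF -EFinM mulrA.
  - by move=> z Ez; rewrite lee_fin mulr_ge0 ?g0.
  - by apply/measurable_EFinP; exact: measurable_funM.
apply: eq_integral => z _; rewrite sumEFin mulr_suml; congr EFin.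
by rewrite [LHS]big_seq [RHS]big_seq; apply: eq_bigr => x; rewrite /h => ->.
Qed.

Lemma sum_integral_le F B E a g (C : R) : measurable E ->
  {in F, forall x, measurable (B x) /\ B x `<=` E} ->
  {in F, forall x, 0 <= a x} ->
  measurable_fun E g -> (forall z, E z -> 0 <= g z) -> 0 <= C ->
  (forall z, E z -> \sum_(x <- F) a x * \1_(B x) z <= C) ->
  (\sum_(x <- F) (a x)%:E * \int[mu]_(z in B x) (g z)%:E <=
   C%:E * \int[mu]_(z in E) (g z)%:E)%E.
Proof.
move=> mE FB Fa mg g0 C0 FC; rewrite (@sum_integral_sets F B E a g)//.
rewrite -ge0_integralZl_EFin//; last exact/measurable_EFinP.
have s0 z : 0 <= \sum_(x <- F) a x * \1_(B x) z.
  by rewrite big_seq sumr_ge0// => x xF; rewrite mulr_ge0 ?Fa.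
have ms : measurable_fun E (fun z => \sum_(x <- F) a x * \1_(B x) z).
  have -> : (fun z => \sum_(x <- F) a x * \1_(B x) z) =
      (fun z => \sum_(x <- F) if x \in F then a x * \1_(B x) z else 0).
    by apply/funext => z; rewrite [LHS]big_seq [RHS]big_seq; apply: eq_bigr => x ->.
  apply: measurable_sum => x; case: (boolP (x \in F)) => xF; last first.
    exact: measurable_cst.
  apply: measurable_funM => //; apply: measurable_indic.
  by have [] := FB x xF.
apply: ge0_le_integral => //.
- by move=> z Ez; rewrite lee_fin mulr_ge0 ?g0.
- by apply/measurable_EFinP; exact: measurable_funM.
- by apply/measurable_EFinP; exact: measurable_funM.
- by move=> z Ez; rewrite lee_fin ler_wpM2r ?g0 ?FC.
Qed.

Lemma integral_le_sum F B E g : measurable E ->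
  {in F, forall x, measurable (B x) /\ B x `<=` E} ->
  measurable_fun E g -> (forall z, E z -> 0 <= g z) ->
  (forall z, E z -> exists2 x, x \in F & B x z) ->
  (\int[mu]_(z in E) (g z)%:E <=
   \sum_(x <- F) \int[mu]_(z in B x) (g z)%:E)%E.
Proof.
move=> mE FB mg g0 FE.
rewrite [leRHS](_ : _ =
    \sum_(x <- F) 1%:E * \int[mu]_(z in B x) (g z)%:E)%E; last first.
  by apply: eq_bigr => x _; rewrite mul1e.
rewrite (@sum_integral_sets F B E (fun=> 1) g)//.
have ms : measurable_fun E (fun z => \sum_(x <- F) 1 * \1_(B x) z : R).
  have -> : (fun z => \sum_(x <- F) 1 * \1_(B x) z) =
      (fun z => \sum_(x <- F) if x \in F then \1_(B x) z else 0 : R).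
    apply/funext => z; rewrite [LHS]big_seq [RHS]big_seq.
    by apply: eq_bigr => x ->; rewrite mul1r.
  apply: measurable_sum => x; case: (boolP (x \in F)) => xF; last first.
    exact: measurable_cst.
  apply: measurable_indic.
  by have [] := FB x xF.
apply: ge0_le_integral => //.
- exact/measurable_EFinP.
- by apply/measurable_EFinP; exact: measurable_funM.
- move=> z Ez; rewrite lee_fin ler_peMl ?g0//.
  have [x xF Bxz] := FE z Ez.
  rewrite (perm_big _ (perm_to_rem xF))/= big_cons mul1r indicE mem_set//.
  by rewrite lerDl sumr_ge0// => y _; rewrite mul1r.
Qed.

Lemma integral_sub E E' g : measurable E -> measurable E' -> E `<=` E' ->
  measurable_fun E' g -> (forall z, E' z -> 0 <= g z) ->
  (\int[mu]_(z in E) (g z)%:E <= \int[mu]_(z in E') (g z)%:E)%E.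
Proof.
move=> mE mE' EE' mg g0; apply: ge0_subset_integral => //.
exact/measurable_EFinP.
Qed.

End integral_families.

Lemma exists_pow2_between (R : realType) (t : R) : 0 <= t ->
  exists k, t <= 2 ^+ k /\ 2 ^+ k <= 2 * (1 + t).
Proof.
move=> t0.
have ex : exists k, t <= 2 ^+ k.
  exists (Num.truncn t).+1; apply/ltW; apply: lt_le_trans (truncnS_gt t) _.
  by rewrite -natrX ler_nat ltnW// ltn_expl.
case: (ex_minnP ex) => k tk kmin; exists k; split => //.
case: k tk kmin => [_ _|k tk kmin]; first by rewrite expr0; lra.
have : ~~ (t <= 2 ^+ k) by apply/negP => /kmin; rewrite ltnn.
by rewrite -ltNge exprS => tk'; lra.
Qed.

(** * Separated sets in a doubling space *)

(** A set [P] with a pseudodistance [D] bounded by 4 (which exceeds pi, the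
    diameter of a sphere) and a weight [w] that is doubling for the balls of
    [P]. *)
Section doubling_space.
Context dd (T : measurableType dd) (R : realType).
Variable mu : {measure set T -> \bar R}.
Variables (P : set T) (D : T -> T -> R) (w : T -> R) (L : R).

Definition dball x (r : R) : set T := [set y | P y /\ D x y <= r].
Definition mass (E : set T) : \bar R := (\int[mu]_(z in E) (w z)%:E)%E.

Hypothesis mP : measurable P.
Hypothesis Dge0 : forall x y, P x -> P y -> 0 <= D x y.
Hypothesis Dxx : forall x, P x -> D x x = 0.
Hypothesis Dsym : forall x y, P x -> P y -> D x y = D y x.
Hypothesis Dtri : forall x y z, P x -> P y -> P z -> D x z <= D x y + D y z.
Hypothesis Dle4 : forall x y, P x -> P y -> D x y <= 4.
Hypothesis mball : forall x r, P x -> measurable (dball x r).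
Hypothesis mw : measurable_fun P w.
Hypothesis w0 : forall x, P x -> 0 <= w x.
Hypothesis L1 : 1 <= L.
Hypothesis doub : forall x r, P x -> 0 < r ->
  (mass (dball x (2 * r)) <= L%:E * mass (dball x r))%E.

Let L0 : 0 <= L.
Proof. exact: le_trans L1. Qed.

Lemma dball_sub x y r s : P x -> P y -> D x y + r <= s ->
  dball y r `<=` dball x s.
Proof.
move=> Px Py rs z [Pz Dyz]; split=> //; apply: le_trans (Dtri Px Py Pz) _.
by apply: le_trans rs; rewrite lerD2l.
Qed.

Lemma dball_subP x r : dball x r `<=` P.
Proof. by move=> y []. Qed.

Lemma dball_all x r : P x -> 4 <= r -> dball x r = P.
Proof.
move=> Px r4; apply/seteqP; split => [y []//|y Py]; split=> //.
exact: le_trans (Dle4 Px Py) r4.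
Qed.

Lemma mass_ge0 E : E `<=` P -> (0 <= mass E)%E.
Proof. by move=> EP; apply: integral_ge0 => z /EP Pz; rewrite lee_fin w0. Qed.

Lemma mass_sub E E' : measurable E -> measurable E' -> E `<=` E' -> E' `<=` P ->
  (mass E <= mass E')%E.
Proof.
move=> mE mE' EE' E'P; apply: integral_sub => //.
  exact: measurable_funS mw.
by move=> z /E'P; exact: w0.
Qed.

Lemma doubling_iter x r k : P x -> 0 < r ->
  (mass (dball x (2 ^+ k * r)) <= (L ^+ k)%:E * mass (dball x r))%E.
Proof.
move=> Px r0; elim: k => [|k IH]; first by rewrite !expr0 mul1r mul1e.
rewrite exprS -mulrA; apply: le_trans (doub Px _) _.
  by rewrite mulr_gt0// exprn_gt0.
by rewrite exprS EFinM -muleA; apply: lee_wpmul2l; rewrite ?lee_fin.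
Qed.

Lemma mass_all_le x r : P x -> 0 < r ->
  exists k, (mass P <= (L ^+ k)%:E * mass (dball x r))%E.
Proof.
move=> Px r0.
have [k [kr _]] := @exists_pow2_between R (4 / r)
  (ltW (divr_gt0 (ltr0n _ 4) r0)).
exists k; rewrite -(@dball_all x (2 ^+ k * r))//; first exact: doubling_iter.
by rewrite -ler_pdivrMr.
Qed.


(** ** Functions with a localized Bernstein inequality *)

(** [bern] is the only trace of polynomials of degree comparable to 1 / h: an
    increment of f near y is controlled by a bound for f that is allowed to grow
    polynomially with the distance to y at the scale h. *)
Section localized_function.
Variables (f : T -> R) (h C M : R) (B : nat).
Hypothesis h0 : 0 < h.
Hypothesis C0 : 0 <= C.
Hypothesis mf : measurable_fun P f.
Hypothesis fM : forall v, P v -> `|f v| <= M.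
Hypothesis bern : forall y u A, P y -> P u -> 0 <= A ->
  (forall v, P v -> `|f v| <= A * (1 + D y v / h) ^+ B) ->
  D y u <= h -> `|f u - f y| <= C * (D y u / h) * A.

Let W x v : R := (1 + D x v / h) ^+ B.

Let W_ge1 x v : P x -> P v -> 1 <= W x v.
Proof.
by move=> Px Pv; rewrite exprn_ege1// lerDl divr_ge0// ?Dge0// ltW.
Qed.

Let W_gt0 x v : P x -> P v -> 0 < W x v.
Proof. by move=> Px Pv; apply: lt_le_trans (W_ge1 Px Pv). Qed.

(** The Peetre maximal function of f. *)
Definition fstar x : R := sup [set `|f v| / W x v | v in P].

Let fstar_has_sup x : P x -> has_sup [set `|f v| / W x v | v in P].
Proof.
move=> Px; split; first by exists (`|f x| / W x x), x.
exists M => _ [v Pv <-]; rewrite ler_pdivrMr ?W_gt0//.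
apply: le_trans (fM Pv) _; apply: ler_peMr; last exact: W_ge1.
exact: le_trans (fM Pv).
Qed.

Lemma fstar_ge x v : P x -> P v -> `|f v| <= fstar x * W x v.
Proof.
move=> Px Pv; rewrite -ler_pdivrMr ?W_gt0//.
by apply: sup_upper_bound; [exact: fstar_has_sup|exists v].
Qed.

Lemma fstar_ge0 x : P x -> 0 <= fstar x.
Proof.
move=> Px; have := fstar_ge Px Px; rewrite /W Dxx// mul0r addr0 expr1n mulr1.
exact: le_trans.
Qed.

Lemma fstar_slow x v : P x -> P v -> fstar v <= fstar x * W x v.
Proof.
move=> Px Pv; apply: ge_sup; first by have [] := fstar_has_sup Pv.
move=> _ [u Pu <-]; rewrite ler_pdivrMr ?W_gt0//.
apply: le_trans (fstar_ge Px Pu) _; rewrite -mulrA.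
rewrite ler_wpM2l ?fstar_ge0// /W -exprMn.
have xv := Dge0 Px Pv; have vu := Dge0 Pv Pu; have xu := Dge0 Px Pu.
have p0 a : 0 <= a -> 0 <= a / h by move=> a0; rewrite divr_ge0// ltW.
apply: lerXn2r; rewrite ?nnegrE ?mulr_ge0 ?addr_ge0 ?p0//.
have : D x u / h <= D x v / h + D v u / h.
  by rewrite -mulrDl ler_pM2r ?invr_gt0//; exact: Dtri.
have : 0 <= D x v / h * (D v u / h) by rewrite mulr_ge0 ?p0.
by rewrite mulrDl mul1r mulrDr mulr1; lra.
Qed.

Lemma osc_le_fstar y u : P y -> P u -> D y u <= h ->
  `|f u - f y| <= C * (D y u / h) * fstar y.
Proof.
move=> Py Pu yu; apply: bern => //; first exact: fstar_ge0.
by move=> v Pv; exact: fstar_ge.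
Qed.

(** Choose v where the supremum defining [fstar x] is nearly attained.  As
    [fstar v <= fstar x * W x v] by [fstar_slow], the oscillation of f on the
    ball of radius h / 2 ^ j about v is at most half of (fstar x) (W x v), of which
    |f v| is at least three quarters. *)
Lemma fstar_attained j x : C <= 2 ^+ j / 2 -> P x ->
  exists2 v, P v & forall u, dball v (h / 2 ^+ j) u ->
    fstar x * W x v <= 4 * `|f u|.
Proof.
move=> Cj Px; have := fstar_ge0 Px; rewrite le_eqVlt => /orP[/eqP f0|fx0].
  by exists x => // u _; rewrite -f0 mul0r mulr_ge0.
have j0 : 0 < 2 ^+ j :> R by rewrite exprn_gt0.
have j1 : 1 <= 2 ^+ j :> R by rewrite exprn_ege1// ler1n.
have fx40 : 0 < fstar x / 4 by rewrite divr_gt0.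
have [_ [v Pv <-] fv] := sup_adherent fx40 (fstar_has_sup Px).
exists v => // u [Pu vu].
have {}fv : 3 / 4 * (fstar x * W x v) <= `|f v|.
  rewrite mulrA -ler_pdivlMr ?W_gt0//; apply: ltW; apply: le_lt_trans fv.
  by rewrite -/(fstar x); lra.
have vuh : D v u / h <= (2 ^+ j)^-1.
  by rewrite ler_pdivrMr// mulrC.
have vuh' : D v u <= h.
  by apply: le_trans vu _; rewrite ler_pdivrMr// ler_peMr// ltW.
have := osc_le_fstar Pv Pu vuh'.
have : C * (D v u / h) * fstar v <= 1 / 2 * (fstar x * W x v).
  have Cvu : C * (D v u / h) <= 1 / 2.
    apply: (@le_trans _ _ (2 ^+ j / 2 * (2 ^+ j)^-1)).
      by apply: ler_pM => //; rewrite divr_ge0 ?Dge0// ltW.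
    by rewrite mulrAC divff ?gt_eqF.
  apply: ler_pM => //; last exact: fstar_slow.
  - by rewrite mulr_ge0// divr_ge0 ?Dge0// ltW.
  - exact: fstar_ge0.
move=> H1 /le_trans/(_ H1) H2.
have := ler_distD (f u) (f v) 0; rewrite !subr0 [`|f v - _|]distrC.
lra.
Qed.

Variable p : R.
Hypothesis p0 : 0 < p.

Definition fpow z : R := `|f z| `^ p * w z.

Lemma measurable_fpow : measurable_fun P fpow.
Proof.
apply: measurable_funM => //; apply: (measurableT_comp (measurable_powR p)).
exact: (measurableT_comp (@normr_measurable R setT) mf).
Qed.

Lemma fpow_ge0 z : P z -> 0 <= fpow z.
Proof. by move=> Pz; rewrite mulr_ge0 ?powR_ge0 ?w0. Qed.

Definition energy (E : set T) : \bar R := (\int[mu]_(z in E) (fpow z)%:E)%E.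

Lemma energy_ge0 E : E `<=` P -> (0 <= energy E)%E.
Proof. by move=> EP; apply: integral_ge0 => z /EP Pz; rewrite lee_fin fpow_ge0. Qed.

Lemma energy_sub E E' : measurable E -> measurable E' -> E `<=` E' -> E' `<=` P ->
  (energy E <= energy E')%E.
Proof.
move=> mE mE' EE' E'P; apply: integral_sub => //.
  exact: measurable_funS measurable_fpow.
by move=> z /E'P; exact: fpow_ge0.
Qed.

Lemma energy_ge E c : measurable E -> E `<=` P -> 0 <= c ->
  (forall z, E z -> c <= `|f z| `^ p) -> (c%:E * mass E <= energy E)%E.
Proof.
move=> mE EP c0 Ec.
have mwE : measurable_fun E w by exact: measurable_funS mw.
rewrite -ge0_integralZl_EFin//.
- apply: ge0_le_integral => //.
  + by move=> z /EP Pz; rewrite -EFinM lee_fin mulr_ge0 ?w0.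
  + by apply/measurable_EFinP; exact: measurable_funM.
  + by apply/measurable_EFinP; exact: measurable_funS measurable_fpow.
  + by move=> z Ez; rewrite -EFinM lee_fin ler_wpM2r ?Ec// w0//; exact: EP.
- by move=> z /EP Pz; rewrite lee_fin w0.
- exact/measurable_EFinP.
Qed.

Lemma energy_le E c : measurable E -> E `<=` P -> 0 <= c ->
  (forall z, E z -> `|f z| `^ p <= c) -> (energy E <= c%:E * mass E)%E.
Proof.
move=> mE EP c0 Ec.
have mwE : measurable_fun E w by exact: measurable_funS mw.
rewrite -ge0_integralZl_EFin//.
- apply: ge0_le_integral => //.
  + by move=> z /EP Pz; rewrite lee_fin fpow_ge0.
  + by apply/measurable_EFinP; exact: measurable_funS measurable_fpow.
  + by apply/measurable_EFinP; exact: measurable_funM.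
  + by move=> z Ez; rewrite -EFinM lee_fin ler_wpM2r ?Ec// w0//; exact: EP.
- by move=> z /EP Pz; rewrite lee_fin w0.
- exact/measurable_EFinP.
Qed.

Variable j : nat.
Hypothesis Cj : C <= 2 ^+ j / 2.
Hypothesis Bp : 2 * L <= (2 ^+ B) `^ p.

(** The constant of [fstar_pow_le]: the first factor is what is lost when
    [fstar x] is compared with |f| on the ball of [fstar_attained] and distances
    are rounded to powers of 2; the second one counts the doublings from radius
    h / 2 ^ j to radius 8 h. *)
Definition fstar_const : R := (4 * 2 ^+ B) `^ p * L ^+ (3 + j).

Let fstar_const_ge0 : 0 <= fstar_const.
Proof. by rewrite mulr_ge0 ?powR_ge0// exprn_ge0. Qed.

(** Masses and energies are then real numbers, which may be divided and
    subtracted. *)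
Section finite_mass.
Hypothesis mass_gt0 : (0 < mass P)%E.
Hypothesis mass_fin : (mass P < +oo)%E.

Definition bmass x r : R := fine (mass (dball x r)).

Lemma bmassE x r : P x -> mass (dball x r) = (bmass x r)%:E.
Proof.
move=> Px; rewrite fineK// ge0_fin_numE; last exact/mass_ge0/dball_subP.
apply: le_lt_trans mass_fin; apply: mass_sub => //; first exact: mball.
exact: dball_subP.
Qed.

Lemma bmass_gt0 x r : P x -> 0 < r -> 0 < bmass x r.
Proof.
move=> Px r0; rewrite -lte_fin -bmassE// lt_neqAle mass_ge0 ?andbT//; last first.
  exact: dball_subP.
apply/eqP => m0; have [k] := mass_all_le Px r0.
by rewrite -m0 mule0 leNgt mass_gt0.
Qed.

Lemma bmass_doubling x r k : P x -> 0 < r ->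
  bmass x (2 ^+ k * r) <= L ^+ k * bmass x r.
Proof.
by move=> Px r0; rewrite -lee_fin EFinM -!bmassE//; exact: doubling_iter.
Qed.

Lemma bmass_le x y r s : P x -> P y -> D x y + r <= s -> bmass y r <= bmass x s.
Proof.
move=> Px Py rs; rewrite -lee_fin -!bmassE//; apply: mass_sub; try exact: mball.
  exact: dball_sub.
exact: dball_subP.
Qed.

Definition separated_seq (eps : R) (F : seq T) :=
  [/\ uniq F, {in F, forall x, P x} &
     {in F &, forall x y, x != y -> eps <= D x y}].

(** The balls of radius eps / 4 about the points of F are disjoint and lie in
    [dball u s], and eps is two doublings away from eps / 4. *)
Lemma packing eps F u s : 0 < eps -> separated_seq eps F -> P u ->
  {in F, forall x, D u x + eps / 4 <= s} ->
  \sum_(x <- F) bmass x eps <= L ^+ 2 * bmass u s.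
Proof.
move=> eps0 [uF FP sepF] Pu Fs.
have e40 : 0 < eps / 4 by rewrite divr_gt0.
apply: (@le_trans _ _ (\sum_(x <- F) L ^+ 2 * bmass x (eps / 4))).
  rewrite big_seq [leRHS]big_seq; apply: ler_sum => x xF.
  have := bmass_doubling 2 (FP x xF) e40.
  by rewrite (_ : 2 ^+ 2 * (eps / 4) = eps)//; field.
rewrite -mulr_sumr ler_wpM2l ?exprn_ge0//.
have sumE : (\sum_(x <- F) bmass x (eps / 4))%:E =
    (\sum_(x <- F) 1%:E * mass (dball x (eps / 4)))%E.
  rewrite -sumEFin [LHS]big_seq [RHS]big_seq; apply: eq_bigr => x xF.
  by rewrite mul1e bmassE//; exact: FP.
rewrite -lee_fin -bmassE// sumE -[leRHS]mul1e.
apply: (@sum_integral_le _ _ _ mu F (fun x => dball x (eps / 4)) (dball u s)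
  (fun=> 1)) => //.
- exact: mball.
- move=> x xF; split; first exact/mball/FP.
  by apply: dball_sub => //; [exact: FP|exact: Fs].
- exact: measurable_funS (dball_subP (r := s)) mw.
- by move=> z [/w0].
move=> z [Pz _].
have [[x xF Bxz]|noF] := pselect (exists2 x, x \in F & dball x (eps / 4) z).
  rewrite (perm_big _ (perm_to_rem xF))/= big_cons big_seq big1 => [|y].
    by rewrite addr0 mul1r indicE; case: (_ \in _).
  rewrite mem_rem_uniq// inE => /andP[yx yF].
  rewrite mul1r indicE memNset//= => -[_ Dyz].
  have := sepF _ _ yF xF yx; apply/negP; rewrite -ltNge.
  have Dxz := Bxz.2; have := Dtri (FP y yF) Pz (FP x xF).
  rewrite (Dsym Pz (FP x xF)); lra.
rewrite big_seq big1// => y yF; rewrite mul1r indicE memNset// => Byz.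
by apply: noF; exists y.
Qed.

(** The points x that contribute lie within r of u, so the masses of their balls of
    radius 2 r are all comparable to that of the same ball about u, and [packing]
    bounds the sum of the numerators. *)
Lemma sum_ratio_le eps F u r : 0 < eps -> eps <= r -> separated_seq eps F ->
  P u ->
  \sum_(x <- F) bmass x eps / bmass x (2 * r) * \1_(dball x r) u <= L ^+ 3.
Proof.
move=> eps0 epsr [uF FP sepF] Pu.
have r0 : 0 < r by exact: lt_le_trans epsr.
have mu0 : 0 < bmass u (2 * r) by rewrite bmass_gt0// mulr_gt0.
apply: (@le_trans _ _ (\sum_(x <- F | D x u <= r)
    L * (bmass u (2 * r))^-1 * bmass x eps)).
  rewrite [leRHS]big_mkcond/= big_seq [leRHS]big_seq.
  apply: ler_sum => x xF; have Px := FP x xF.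
  rewrite indicE; case: ifPn => Dxu; last first.
    by rewrite memNset ?mulr0// => -[_]; exact/negP.
  rewrite mem_set// mulr1 mulrC; apply: ler_wpM2r; first exact/ltW/bmass_gt0.
  have m20 : 0 < bmass x (2 * r) by rewrite bmass_gt0// mulr_gt0.
  rewrite ler_pdivlMr// mulrC ler_pdivrMr//.
  have := @bmass_doubling x (2 * r) 1 Px.
  rewrite !expr1 => /(_ (mulr_gt0 (ltr0n _ 2) r0)); apply: le_trans.
  by apply: bmass_le => //; lra.
rewrite -mulr_sumr exprS -mulrA ler_wpM2l// mulrC ler_pdivrMr//.
rewrite -big_filter; apply: packing => //.
  split; first exact: filter_uniq.
    by move=> x; rewrite mem_filter => /andP[_ /FP].
  by move=> x y; rewrite !mem_filter => /andP[_ xF] /andP[_ yF]; exact: sepF.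
move=> x; rewrite mem_filter => /andP[Dxu xF]; rewrite Dsym//; last exact: FP.
lra.
Qed.

Let benergy E := fine (energy E).

Lemma energy_fin E : measurable E -> E `<=` P -> (energy E < +oo)%E.
Proof.
move=> mE EP; apply: le_lt_trans (energy_sub mE mP EP (@subset_refl _ _)) _.
apply: le_lt_trans (@energy_le P (`|M| `^ p) mP (@subset_refl _ _) _ _) _.
- exact: powR_ge0.
- move=> z Pz; apply: (ge0_ler_powR (ltW p0)); rewrite ?nnegrE//.
  exact: le_trans (fM Pz) (ler_norm _).
- by rewrite lte_mul_pinfty ?lee_fin ?powR_ge0.
Qed.

Lemma benergyE E : measurable E -> E `<=` P -> energy E = (benergy E)%:E.
Proof.
by move=> mE EP; rewrite fineK// ge0_fin_numE ?energy_fin// energy_ge0.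
Qed.

Lemma benergy_ge0 E : measurable E -> E `<=` P -> 0 <= benergy E.
Proof. by move=> mE EP; rewrite fine_ge0// energy_ge0. Qed.

Lemma powR_exprn (a : R) k : 0 <= a -> (a ^+ k) `^ p = (a `^ p) ^+ k.
Proof. by move=> a0; rewrite -!powR_mulrn ?powR_ge0// powRAC. Qed.

(** Let v be the point of [fstar_attained] and 2 ^ k comparable to 1 + D x v / h.
    On the ball about v, |f| ^ p is at least of the order of
    fstar x ^ p 2 ^ (k B p), and that ball lies in the ball about x of radius
    2 ^ (k + 1) h.  Its mass is smaller than that of the ball about x by a factor
    L ^ k at most, up to a constant, so the hypothesis 2 L <= 2 ^ (B p) leaves a
    gain of 2 ^ -k. *)
Lemma fstar_pow_le x : P x -> exists k,
  fstar x `^ p * bmass x (2 * (2 ^+ k.+1 * h)) <=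
  fstar_const * (2 ^+ k)^-1 * benergy (dball x (2 ^+ k.+1 * h)).
Proof.
move=> Px; have [v Pv fv] := fstar_attained Cj Px.
set t := D x v / h; have t0 : 0 <= t by rewrite divr_ge0 ?Dge0 ?ltW.
have [k [tk kt]] := exists_pow2_between t0; exists k.
have j0 : 0 < 2 ^+ j :> R by rewrite exprn_gt0.
have j1 : 1 <= 2 ^+ j :> R by rewrite exprn_ege1// ler1n.
have k1 : 1 <= 2 ^+ k :> R by rewrite exprn_ege1// ler1n.
have hj0 : 0 < h / 2 ^+ j by rewrite divr_gt0.
have hj : h / 2 ^+ j <= h by rewrite ler_pdivrMr// ler_peMr// ltW.
have xv : D x v <= 2 ^+ k * h by rewrite -ler_pdivrMr.
have kh : h <= 2 ^+ k * h by rewrite ler_peMl// ltW.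
pose a := fstar x `^ p; have a0 : 0 <= a by exact: powR_ge0.
pose G := ((2 ^+ B) `^ p) ^+ k.
have G0 : 0 < G by rewrite exprn_gt0// powR_gt0// exprn_gt0.
pose e := (4 * 2 ^+ B) `^ p.
have e0 : 0 < e by rewrite powR_gt0// mulr_gt0// exprn_gt0.
have low u : dball v (h / 2 ^+ j) u -> a * G / e <= `|f u| `^ p.
  move=> vu; rewrite ler_pdivrMr// mulrC [leRHS]mulrC.
  rewrite /a /G /e -powR_exprn ?exprn_ge0//.
  rewrite -!powRM ?exprn_ge0 ?fstar_ge0 ?mulr_ge0 ?exprn_ge0//.
  apply: (ge0_ler_powR (ltW p0)); rewrite ?nnegrE ?mulr_ge0 ?exprn_ge0 ?fstar_ge0//.
  apply: (@le_trans _ _ (2 ^+ B * (fstar x * W x v))).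
    rewrite mulrC mulrCA ler_wpM2l ?fstar_ge0// exprAC /W -exprMn.
    by apply: lerXn2r; rewrite ?nnegrE ?mulr_ge0 ?addr_ge0 ?exprn_ge0.
  by rewrite -mulrA [leRHS]mulrCA ler_wpM2l ?exprn_ge0//; exact: fv.
pose r := 2 ^+ k.+1 * h.
have aG : a * G / e * bmass v (h / 2 ^+ j) <= benergy (dball x r).
  rewrite -lee_fin EFinM -bmassE// -benergyE; [|exact: mball|exact: dball_subP].
  apply: le_trans (energy_ge (mball _ Pv) (@dball_subP v _) _ low) _.
    by rewrite divr_ge0 ?mulr_ge0// ltW.
  apply: energy_sub; [exact: mball|exact: mball| |exact: dball_subP].
  by apply: dball_sub => //; rewrite /r exprS; lra.
have mx : bmass x (2 * r) <= L ^+ (k + (3 + j)) * bmass v (h / 2 ^+ j).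
  apply: le_trans (bmass_doubling _ Pv hj0); apply: bmass_le => //.
  rewrite Dsym// !exprD mulrA -[_ / _]mulrC mulrA.
  rewrite [leRHS](_ : _ = 2 ^+ k * 2 ^+ 3 * h); last by field; rewrite gt_eqF.
  by rewrite /r exprS; lra.
have LG : L ^+ k / G <= (2 ^+ k)^-1.
  rewrite ler_pdivrMr// mulrC ler_pdivlMr ?exprn_gt0// -exprMn /G.
  by apply: lerXn2r; rewrite ?nnegrE ?mulr_ge0 ?powR_ge0// mulrC.
have bE0 : 0 <= benergy (dball x r).
  by apply: benergy_ge0; [exact: mball|exact: dball_subP].
apply: (@le_trans _ _ (e * L ^+ (3 + j) * (L ^+ k / G) * benergy (dball x r))).
  apply: le_trans (ler_wpM2l a0 mx) _.
  have -> : a * (L ^+ (k + (3 + j)) * bmass v (h / 2 ^+ j)) =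
      e * L ^+ (3 + j) * (L ^+ k / G) * (a * G / e * bmass v (h / 2 ^+ j)).
    by rewrite exprD; field; rewrite !gt_eqF.
  apply: ler_wpM2l aG.
  apply: mulr_ge0; first by rewrite mulr_ge0 ?exprn_ge0// ltW.
  by rewrite divr_ge0 ?exprn_ge0// ltW.
rewrite ler_wpM2r// ler_wpM2l// mulr_ge0 ?exprn_ge0//; exact: ltW.
Qed.

(** Exchanging sum and integral reduces this to the pointwise bound
    [sum_ratio_le]. *)
Lemma sum_local_energy_le eps F r : 0 < eps -> eps <= r -> separated_seq eps F ->
  \sum_(x <- F) bmass x eps / bmass x (2 * r) * benergy (dball x r) <=
  L ^+ 3 * benergy P.
Proof.
move=> eps0 epsr sF; have [uF FP sepF] := sF.
have r0 : 0 < r by exact: lt_le_trans epsr.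
rewrite -lee_fin EFinM -sumEFin.
have -> : (\sum_(x <- F) (bmass x eps / bmass x (2 * r) *
      benergy (dball x r))%:E =
    \sum_(x <- F) (bmass x eps / bmass x (2 * r))%:E * energy (dball x r))%E.
  rewrite [LHS]big_seq [RHS]big_seq; apply: eq_bigr => x xF.
  rewrite benergyE ?EFinM//; first by apply: mball; exact: FP.
  exact: dball_subP.
rewrite -benergyE//.
apply: (@sum_integral_le _ _ _ mu F (fun x => dball x r) P
    (fun x => bmass x eps / bmass x (2 * r)) fpow) => //.
- by move=> x xF; split; [exact/mball/FP|exact: dball_subP].
- move=> x xF; rewrite divr_ge0// ltW// bmass_gt0//; try exact: FP.
  by rewrite mulr_gt0.
- exact: measurable_fpow.
- exact: fpow_ge0.
- by rewrite exprn_ge0.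
- by move=> z Pz; exact: sum_ratio_le.
Qed.

Lemma sum_inv_pow2_le2 K : \sum_(k < K) (2 ^+ k)^-1 <= 2 :> R.
Proof.
suff -> : \sum_(k < K) (2 ^+ k)^-1 = 2 - 2 * (2 ^+ K)^-1 :> R.
  by rewrite lerBlDr lerDl mulr_ge0// invr_ge0 exprn_ge0.
elim: K => [|K IH]; first by rewrite big_ord0 expr0 invr1; ring.
rewrite big_ord_recr/= IH exprS; field.
by rewrite expf_neq0// pnatr_eq0.
Qed.

(** The exponent k of [fstar_pow_le] depends on x, so the bounds for all k are
    added; the factors 2 ^ -k make this harmless. *)
Lemma sum_fstar_le eps F : 0 < eps -> eps <= h -> separated_seq eps F ->
  \sum_(x <- F) fstar x `^ p * bmass x eps <= 2 * fstar_const * L ^+ 3 * benergy P.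
Proof.
move=> eps0 epsh sF; have [uF FP sepF] := sF.
pose r k : R := 2 ^+ k.+1 * h.
pose q k x := fstar_const * (2 ^+ k)^-1 *
  (bmass x eps / bmass x (2 * r k) * benergy (dball x (r k))).
have r0 k : 0 < r k by rewrite mulr_gt0// exprn_gt0.
have rh k : eps <= r k.
  by apply: le_trans epsh _; rewrite ler_peMl ?exprn_ege1 ?ler1n// ltW.
have q0 k x : P x -> 0 <= q k x.
  move=> Px; apply: mulr_ge0; first by rewrite mulr_ge0 ?invr_ge0 ?exprn_ge0.
  apply: mulr_ge0; last by apply: benergy_ge0; [exact: mball|exact: dball_subP].
  by rewrite divr_ge0// ltW// bmass_gt0// mulr_gt0.
have [K HK] : exists K, {in F, forall x, exists2 k, (k < K)%N &
    fstar x `^ p * bmass x eps <= q k x}.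
  have {sF uF sepF} : {in F, forall x, P x} := FP.
  elim: F {FP} => [|x F IH] FP; first by exists 0%N.
  have [|K HK] := IH; first by move=> y yF; apply: FP; rewrite inE yF orbT.
  have Px : P x by apply: FP; rewrite mem_head.
  have [k Hk] := fstar_pow_le Px.
  exists (maxn k.+1 K) => y; rewrite inE => /orP[/eqP ->|yF].
    exists k; first by rewrite leq_max ltnSn.
    rewrite /q mulrA mulrC -[leRHS]mulrA [leRHS]mulrCA.
    rewrite -[leRHS]mulrA ler_wpM2l//; first by rewrite ltW// bmass_gt0.
    by rewrite mulrC ler_pdivlMr// bmass_gt0// mulr_gt0.
  by have [l lK Hl] := HK y yF; exists l => //; rewrite leq_max lK orbT.
apply: (@le_trans _ _ (\sum_(x <- F) \sum_(k < K) q k x)).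
  rewrite big_seq [leRHS]big_seq; apply: ler_sum => x xF.
  have [k kK] := HK x xF; move/le_trans; apply.
  rewrite (bigD1 (Ordinal kK))//= lerDl; apply: sumr_ge0 => i _.
  by apply: q0; exact: FP.
rewrite exchange_big/=.
apply: (@le_trans _ _ (\sum_(k < K) fstar_const * (2 ^+ k)^-1 *
    (L ^+ 3 * benergy P))).
  apply: ler_sum => k _; rewrite -mulr_sumr ler_wpM2l//.
    by rewrite mulr_ge0// invr_ge0 exprn_ge0.
  exact: sum_local_energy_le.
rewrite -mulr_suml -mulr_sumr -[leRHS]mulrA ler_wpM2r//.
  by rewrite mulr_ge0 ?exprn_ge0// benergy_ge0.
by rewrite [2 * _]mulrC ler_wpM2l// sum_inv_pow2_le2.
Qed.

Lemma sup_le_fstar x eps : P x -> 0 <= eps -> eps <= h ->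
  (ereal_sup [set (`|f y| `^ p)%:E | y in dball x eps] <=
   ((2 ^+ B) `^ p * fstar x `^ p)%:E)%E.
Proof.
move=> Px eps0 epsh; apply: ge_ereal_sup => _ [y [Py xy] <-].
rewrite lee_fin -powRM ?exprn_ge0 ?fstar_ge0//.
apply: (ge0_ler_powR (ltW p0)); rewrite ?nnegrE ?mulr_ge0 ?exprn_ge0 ?fstar_ge0//.
apply: le_trans (fstar_ge Px Py) _; rewrite mulrC ler_wpM2r ?fstar_ge0//.
have t0 : 0 <= D x y / h by rewrite divr_ge0 ?Dge0// ltW.
have t1 : D x y / h <= 1 by rewrite ler_pdivrMr// mul1r (le_trans xy).
by apply: lerXn2r; rewrite ?nnegrE ?addr_ge0//; lra.
Qed.

Lemma sum_sup_le_finite eps F : 0 < eps -> eps <= h -> separated_seq eps F ->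
  (\sum_(x <- F) ereal_sup [set (`|f y| `^ p)%:E | y in dball x eps] *
     mass (dball x eps) <=
   ((2 ^+ B) `^ p * (2 * fstar_const * L ^+ 3))%:E * energy P)%E.
Proof.
move=> eps0 epsh sF; have [uF FP sepF] := sF.
apply: (@le_trans _ _ (\sum_(x <- F)
    ((2 ^+ B) `^ p * (fstar x `^ p * bmass x eps))%:E)%E).
  rewrite big_seq [leRHS]big_seq; apply: lee_sum => x xF; have Px := FP x xF.
  rewrite mulrA EFinM -bmassE//; apply: lee_wpmul2r.
    exact/mass_ge0/dball_subP.
  by apply: sup_le_fstar => //; exact: ltW.
rewrite sumEFin -mulr_sumr benergyE// -EFinM lee_fin -[leRHS]mulrA.
by rewrite ler_wpM2l ?powR_ge0//; exact: sum_fstar_le.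
Qed.

(** By doubling, all balls of radius eps have at least a fixed fraction of the total
    mass, and [packing] bounds the sum of their masses. *)
Lemma separated_finite_set eps (Z : set T) : 0 < eps -> Z `<=` P ->
  (forall x y, Z x -> Z y -> x <> y -> eps <= D x y) -> finite_set Z.
Proof.
move=> eps0 ZP sepZ; apply: contrapT => infZ.
have [k [k4 _]] := @exists_pow2_between R (4 / eps)
  (ltW (divr_gt0 (ltr0n _ 4) eps0)).
have mP0 : 0 < fine (mass P) by rewrite fine_gt0// mass_gt0.
have mPE : mass P = (fine (mass P))%:E.
  by rewrite fineK// ge0_fin_numE// mass_ge0.
have low x : P x -> fine (mass P) <= L ^+ k * bmass x eps.
  move=> Px; rewrite -lee_fin EFinM -bmassE// -mPE.
  rewrite -(@dball_all x (2 ^+ k * eps))//; first exact: doubling_iter.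
  by rewrite -ler_pdivrMr.
pose N := Num.truncn (L ^+ k * L ^+ 2).
have [F FZ NF] := infinite_set_fset N.+1 infZ.
have sF : separated_seq eps (finmap.enum_fset F).
  split; first exact: finmap.fset_uniq.
    by move=> x xF; apply/ZP/FZ.
  by move=> x y xF yF /eqP xy; apply: sepZ => //; exact: FZ.
have [u uF] : exists u, u \in finmap.enum_fset F.
  case: (finmap.enum_fset F) NF => [//|u s _]; by exists u; rewrite mem_head.
have Pu : P u by exact/ZP/FZ.
have := @packing eps (finmap.enum_fset F) u (4 + eps / 4) eps0 sF Pu.
have -> : bmass u (4 + eps / 4) = fine (mass P).
  by rewrite /bmass dball_all// lerDl divr_ge0// ltW.
have pF : {in finmap.enum_fset F, forall x, D u x + eps / 4 <= 4 + eps / 4}.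
  by move=> x xF; rewrite lerD2r Dle4//; exact/ZP/FZ.
move=> /(_ pF) H.
have Lk0 : 0 <= L ^+ k by rewrite exprn_ge0.
have : (size (finmap.enum_fset F))%:R * fine (mass P) <=
    L ^+ k * L ^+ 2 * fine (mass P).
  rewrite -[leRHS]mulrA; apply: le_trans (ler_wpM2l Lk0 H).
  rewrite mulr_sumr -[X in X%:R]count_predT -sum1_count natr_sum mulr_suml.
  rewrite big_seq [leRHS]big_seq; apply: ler_sum => x xF.
  by rewrite mul1r low//; exact/ZP/FZ.
rewrite ler_pM2r// leNgt => /negP; apply.
by apply: lt_le_trans (truncnS_gt _) _; rewrite ler_nat.
Qed.

(** On a ball about x, |f| exceeds its infimum by at most
    [2 * C * del * fstar x]; the p-th powers of these errors, times 2 ^ p, sum up,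
    by [sum_fstar_le], to at most half of the energy, which is absorbed in the
    left-hand side since it is finite. *)
Lemma energy_le_sum_inf_finite eps del (Z : set T) : 0 < eps -> eps <= del * h ->
  0 <= del <= 1 -> (4 * C * del) `^ p * (2 * fstar_const * L ^+ 3) <= 1 / 2 ->
  Z `<=` P -> (forall x y, Z x -> Z y -> x <> y -> eps <= D x y) ->
  (forall y, P y -> exists2 x, Z x & dball x eps y) ->
  (energy P <= (2 * 2 `^ p)%:E * \esum_(x in Z)
     (ereal_inf [set (`|f y| `^ p)%:E | y in dball x eps] * mass (dball x eps)))%E.
Proof.
move=> eps0 epsdel /andP[del0 del1] small ZP sepZ covZ.
have epsh : eps <= h by apply: le_trans epsdel _; rewrite ler_piMl// ltW.
have finZ := separated_finite_set eps0 ZP sepZ.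
pose F := finmap.enum_fset (fset_set Z).
have FZ x : x \in F -> Z x by rewrite /F in_fset_set// inE.
have FP : {in F, forall x, P x} by move=> x /FZ /ZP.
have sF : separated_seq eps F.
  split => //; first exact: finmap.fset_uniq.
  by move=> x y /FZ xZ /FZ yZ /eqP xy; exact: sepZ.
pose I x := fine (ereal_inf [set (`|f y| `^ p)%:E | y in dball x eps]).
have IE x : P x -> ereal_inf [set (`|f y| `^ p)%:E | y in dball x eps] = (I x)%:E.
  move=> Px; rewrite fineK// ge0_fin_numE.
    apply: le_lt_trans (ltry (`|f x| `^ p)); apply: ereal_inf_lbound.
    by exists x => //; split => //; rewrite Dxx// ltW.
  by apply: le_ereal_inf_tmp => _ [y _ <-]; rewrite lee_fin powR_ge0.
have I0 x : P x -> 0 <= I x.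
  move=> Px; rewrite -lee_fin -IE//.
  by apply: le_ereal_inf_tmp => _ [y _ <-]; rewrite lee_fin powR_ge0.
have sumE : (\esum_(x in Z) (ereal_inf [set (`|f y| `^ p)%:E | y in dball x eps] *
    mass (dball x eps)) = (\sum_(x <- F) I x * bmass x eps)%:E)%E.
  rewrite esum_fset//; last first.
    move=> x; rewrite inE => /ZP Px; rewrite IE// bmassE// -EFinM lee_fin.
    by rewrite mulr_ge0 ?I0// ltW// bmass_gt0.
  rewrite fsbig_finite//= -sumEFin -/F [LHS]big_seq [RHS]big_seq.
  by apply: eq_bigr => x /FP Px; rewrite IE// bmassE// EFinM.
pose o x := 2 * C * del * fstar x.
have o0 x : P x -> 0 <= o x by move=> Px; rewrite !mulr_ge0 ?fstar_ge0.
have oscle x y z : P x -> dball x eps y -> dball x eps z -> `|f z| <= `|f y| + o x.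
  move=> Px [Py xy] [Pz xz].
  have osc1 u : P u -> D x u <= eps -> `|f u - f x| <= C * del * fstar x.
    move=> Pu xu; apply: le_trans (osc_le_fstar Px Pu (le_trans xu epsh)) _.
    rewrite ler_wpM2r ?fstar_ge0// ler_wpM2l// ler_pdivrMr//.
    exact: le_trans xu epsdel.
  have := osc1 _ Py xy; have := osc1 _ Pz xz.
  have := ler_distD (f x) (f z) (f y); have := ler_distD (f y) (f z) 0.
  rewrite !subr0 [`|f x - f y|]distrC /o; lra.
have local x : P x -> (energy (dball x eps) <=
    (2 `^ p * (I x + o x `^ p) * bmass x eps)%:E)%E.
  move=> Px; rewrite EFinM -bmassE//; apply: energy_le.
  - exact: mball.
  - exact: dball_subP.
  - by rewrite mulr_ge0 ?addr_ge0 ?powR_ge0// I0.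
  move=> z xz; rewrite -ler_pdivrMl ?powR_gt0// -lerBlDr.
  rewrite -lee_fin -IE//; apply: le_ereal_inf_tmp => _ [y xy <-].
  rewrite lee_fin lerBlDr ler_pdivrMl ?powR_gt0//.
  apply: (@le_trans _ _ ((2 * Num.max `|f y| (o x)) `^ p)).
    apply: (ge0_ler_powR (ltW p0)); rewrite ?nnegrE ?mulr_ge0 ?le_max ?normr_ge0//.
    apply: le_trans (oscle x y z Px xy xz) _.
    have : `|f y| <= Num.max `|f y| (o x) by rewrite le_max lexx.
    have : o x <= Num.max `|f y| (o x) by rewrite le_max lexx orbT.
    lra.
  rewrite powRM ?le_max ?normr_ge0// ler_wpM2l ?powR_ge0//.
  by have [_|_] := leP `|f y| (o x); [rewrite lerDr|rewrite lerDl]; exact: powR_ge0.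
have main : benergy P <=
    2 `^ p * (\sum_(x <- F) I x * bmass x eps) + 1 / 2 * benergy P.
  rewrite -lee_fin -benergyE//.
  apply: le_trans (@integral_le_sum _ _ _ mu F (fun x => dball x eps) P fpow
    mP _ measurable_fpow fpow_ge0 _) _.
  - by move=> x /FP Px; split; [exact: mball|exact: dball_subP].
  - move=> z /covZ[x Zx xz]; exists x => //.
    by rewrite /F in_fset_set// inE.
  apply: (@le_trans _ _ (\sum_(x <- F)
      (2 `^ p * (I x + o x `^ p) * bmass x eps)%:E)%E).
    rewrite big_seq [leRHS]big_seq; apply: lee_sum => x /FP Px; exact: local.
  rewrite sumEFin lee_fin.
  have -> : \sum_(x <- F) 2 `^ p * (I x + o x `^ p) * bmass x eps =
      2 `^ p * (\sum_(x <- F) I x * bmass x eps) +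
      (4 * C * del) `^ p * \sum_(x <- F) fstar x `^ p * bmass x eps.
    rewrite !mulr_sumr -big_split/= [LHS]big_seq [RHS]big_seq.
    apply: eq_bigr => x /FP Px.
    rewrite /o powRM ?fstar_ge0 ?mulr_ge0//.
    have -> : 4 * C * del = 2 * (2 * C * del) by ring.
    by rewrite [in RHS]powRM ?mulr_ge0//; ring.
  rewrite lerD2l; apply: (@le_trans _ _
    ((4 * C * del) `^ p * (2 * fstar_const * L ^+ 3 * benergy P))).
    by rewrite ler_wpM2l ?powR_ge0//; exact: sum_fstar_le.
  by rewrite mulrA ler_wpM2r// benergy_ge0.
rewrite sumE benergyE// -EFinM lee_fin; lra.
Qed.

End finite_mass.

Lemma infinite_mass_ball : mass P = +oo%E -> forall x r, P x -> 0 < r ->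
  mass (dball x r) = +oo%E.
Proof.
move=> moo x r Px r0; have [k] := mass_all_le Px r0.
rewrite moo leye_eq => /eqP H; apply/eqP; rewrite -leye_eq leNgt.
apply/negP => fin; move: H; apply/eqP; rewrite lt_eqF//.
by rewrite lte_mul_pinfty ?lee_fin ?exprn_ge0// ge0_fin_numE// mass_ge0.
Qed.

(** By [fstar_attained], |f| is bounded below by a positive constant on a ball. *)
Lemma infinite_energy x : mass P = +oo%E -> P x -> 0 < fstar x -> energy P = +oo%E.
Proof.
move=> moo Px fx0; have [v Pv fv] := fstar_attained Cj Px.
have r0 : 0 < h / 2 ^+ j by rewrite divr_gt0// exprn_gt0.
have b0 : 0 < fstar x * W x v / 4 by rewrite divr_gt0// mulr_gt0 ?W_gt0.
have low u : dball v (h / 2 ^+ j) u -> (fstar x * W x v / 4) `^ p <= `|f u| `^ p.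
  move=> vu; apply: (ge0_ler_powR (ltW p0)); rewrite ?nnegrE ?(ltW b0)//.
  by rewrite ler_pdivrMr// [leRHS]mulrC; exact: fv.
have := energy_ge (mball _ Pv) (@dball_subP v _) (powR_ge0 _ _) low.
rewrite infinite_mass_ball// gt0_muley ?lte_fin ?powR_gt0// leye_eq => /eqP E.
apply/eqP; rewrite -leye_eq -E; apply: energy_sub => //; first exact: mball.
exact: dball_subP.
Qed.

Theorem sum_sup_le eps F : 0 < eps -> eps <= h -> separated_seq eps F ->
  (\sum_(x <- F) ereal_sup [set (`|f y| `^ p)%:E | y in dball x eps] *
     mass (dball x eps) <=
   ((2 ^+ B) `^ p * (2 * fstar_const * L ^+ 3))%:E * energy P)%E.
Proof.
move=> eps0 epsh sF; have [uF FP sepF] := sF.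
have K0 : 0 < (2 ^+ B) `^ p * (2 * fstar_const * L ^+ 3).
  have L0' : 0 < L by exact: lt_le_trans L1.
  have B0 : 0 < 2 ^+ B :> R by rewrite exprn_gt0.
  rewrite mulr_gt0 ?powR_gt0// mulr_gt0 ?exprn_gt0// mulr_gt0//.
  by rewrite /fstar_const mulr_gt0 ?exprn_gt0// powR_gt0// mulr_gt0// exprn_gt0.
have R0 : (0 <= ((2 ^+ B) `^ p * (2 * fstar_const * L ^+ 3))%:E * energy P)%E.
  by rewrite mule_ge0 ?energy_ge0// lee_fin ltW.
have := mass_ge0 (@subset_refl _ P); rewrite le_eqVlt => /orP[/eqP m0|m0].
  rewrite big_seq big1// => x xF.
  have -> : mass (dball x eps) = 0%E; last by rewrite mule0.
  apply/eqP; rewrite eq_le mass_ge0 ?andbT; last exact: dball_subP.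
  rewrite m0; apply: mass_sub => //; last exact: dball_subP.
  by apply: mball; exact: FP.
have [moo|mfin] := eqVneq (mass P) +oo%E; last first.
  by apply: sum_sup_le_finite => //; rewrite lt_neqAle mfin leey.
have [[x Px fx]|nofx] := pselect (exists2 x, P x & 0 < fstar x).
  by rewrite (infinite_energy moo Px fx) gt0_muley ?leey// lte_fin.
apply: le_trans R0; rewrite big_seq; apply: sume_le0 => x xF; have Px := FP x xF.
have fx0 : fstar x = 0.
  apply/eqP; rewrite eq_le fstar_ge0// andbT leNgt; apply/negP => fx.
  by apply: nofx; exists x.
apply: mule_le0_ge0; last exact/mass_ge0/dball_subP.
apply: ge_ereal_sup => _ [y [Py _] <-].
have : `|f y| <= 0 by have := fstar_ge Px Py; rewrite fx0 mul0r.
by rewrite normr_le0 => /eqP ->; rewrite normr0 powR0 ?gt_eqF.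
Qed.

(** If the mass is infinite and f does not vanish, the ball of [fstar_attained] about
    v contains the whole ball of radius eps about a point z of Z near v, so that
    already the term of z is infinite; this is what [2 * del <= (2 ^+ j)^-1]
    ensures. *)
Theorem energy_le_sum_inf eps del (Z : set T) : 0 < eps -> eps <= del * h ->
  0 <= del <= 1 -> (4 * C * del) `^ p * (2 * fstar_const * L ^+ 3) <= 1 / 2 ->
  2 * del <= (2 ^+ j)^-1 ->
  Z `<=` P -> (forall x y, Z x -> Z y -> x <> y -> eps <= D x y) ->
  (forall y, P y -> exists2 x, Z x & dball x eps y) ->
  (energy P <= (2 * 2 `^ p)%:E * \esum_(x in Z)
     (ereal_inf [set (`|f y| `^ p)%:E | y in dball x eps] * mass (dball x eps)))%E.
Proof.
move=> eps0 epsdel del01 small delj ZP sepZ covZ.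
have K0 : 0 < 2 * 2 `^ p :> R by rewrite mulr_gt0// powR_gt0.
have inf0 x : (0 <= ereal_inf [set (`|f y| `^ p)%:E | y in dball x eps])%E.
  by apply: le_ereal_inf_tmp => _ [y _ <-]; rewrite lee_fin powR_ge0.
have term0 x : (0 <= ereal_inf [set (`|f y| `^ p)%:E | y in dball x eps] *
    mass (dball x eps))%E.
  by rewrite mule_ge0// mass_ge0//; exact: dball_subP.
have R0 : (0 <= (2 * 2 `^ p)%:E * \esum_(x in Z)
    (ereal_inf [set (`|f y| `^ p)%:E | y in dball x eps] * mass (dball x eps)))%E.
  by rewrite mule_ge0 ?esum_ge0// lee_fin ltW.
have bound c' : 0 <= c' -> (forall z, P z -> `|f z| `^ p <= c') ->
    (energy P <= c'%:E * mass P)%E.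
  by move=> *; exact: energy_le.
have := mass_ge0 (@subset_refl _ P); rewrite le_eqVlt => /orP[/eqP m0|m0].
  apply: le_trans (bound (`|M| `^ p) (powR_ge0 _ _) _) _; last by rewrite -m0 mule0.
  move=> z Pz; apply: (ge0_ler_powR (ltW p0)); rewrite ?nnegrE//.
  exact: le_trans (fM Pz) (ler_norm _).
have [moo|mfin] := eqVneq (mass P) +oo%E; last first.
  apply: energy_le_sum_inf_finite epsdel del01 small ZP sepZ covZ => //.
  by rewrite lt_neqAle mfin leey.
have [[x Px fx]|nofx] := pselect (exists2 x, P x & 0 < fstar x); last first.
  have f0 z : P z -> `|f z| `^ p <= 0.
    move=> Pz; have := fstar_ge Pz Pz; rewrite (_ : fstar z = 0) ?mul0r; last first.
      apply/eqP; rewrite eq_le fstar_ge0// andbT leNgt; apply/negP => fz.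
      by apply: nofx; exists z.
    by rewrite normr_le0 => /eqP ->; rewrite normr0 powR0 ?gt_eqF.
  by apply: le_trans (bound 0 (lexx _) f0) _; rewrite mul0e.
have [v Pv fv] := fstar_attained Cj Px.
have b0 : 0 < fstar x * W x v / 4 by rewrite divr_gt0// mulr_gt0 ?W_gt0.
have [z Zz [_ zv]] := covZ v Pv; have Pz := ZP z Zz.
have infz : (((fstar x * W x v / 4) `^ p)%:E <=
    ereal_inf [set (`|f y| `^ p)%:E | y in dball z eps])%E.
  apply: le_ereal_inf_tmp => _ [y [Py zy] <-]; rewrite lee_fin.
  apply: (ge0_ler_powR (ltW p0)); rewrite ?nnegrE ?(ltW b0)//.
  rewrite ler_pdivrMr// [leRHS]mulrC; apply: fv; split => //.
  have := Dtri Pv Pz Py; rewrite (Dsym Pv Pz) => vy.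
  have : 2 * del * h <= h / 2 ^+ j by rewrite mulrC ler_wpM2l// ltW.
  lra.
have -> : (\esum_(x in Z) (ereal_inf [set (`|f y| `^ p)%:E | y in dball x eps] *
    mass (dball x eps)) = +oo)%E; last by rewrite gt0_muley ?leey// lte_fin.
apply/eqP; rewrite -leye_eq; apply: esum_ge; exists [set z].
  by split => // _ ->.
rewrite fsbig_set1 infinite_mass_ball// gt0_muley//.
by apply: lt_le_trans infz; rewrite lte_fin powR_gt0.
Qed.

End localized_function.
End doubling_space.

(** * Inner products and angles *)

Section dot_product.
Variables (R : realType) (n : nat).
Implicit Types (u v x : 'rV[R]_n) (a : R).

Lemma dotrE u v : dotr u v = \sum_i u ord0 i * v ord0 i.
Proof. by rewrite /dotr mxE; apply: eq_bigr => i _; rewrite mxE. Qed.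

Lemma dotrC u v : dotr u v = dotr v u.
Proof. by rewrite !dotrE; apply: eq_bigr => i _; rewrite mulrC. Qed.

Lemma dotrDl u v x : dotr (u + v) x = dotr u x + dotr v x.
Proof. by rewrite /dotr mulmxDl mxE. Qed.

Lemma dotrZl a u v : dotr (a *: u) v = a * dotr u v.
Proof. by rewrite /dotr -scalemxAl mxE. Qed.

Lemma dotrDr u v x : dotr x (u + v) = dotr x u + dotr x v.
Proof. by rewrite dotrC dotrDl !(dotrC x). Qed.

Lemma dotrZr a u v : dotr u (a *: v) = a * dotr u v.
Proof. by rewrite dotrC dotrZl dotrC. Qed.

Lemma dotr_ge0 u : 0 <= dotr u u.
Proof. by rewrite dotrE sumr_ge0// => i _; rewrite -expr2 sqr_ge0. Qed.

Lemma dotr_eq0 u : dotr u u = 0 -> u = 0.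
Proof.
rewrite dotrE => /eqP; rewrite psumr_eq0 => [/allP u0|i _]; last first.
  by rewrite -expr2 sqr_ge0.
apply/rowP => i; rewrite mxE; have := u0 i; rewrite mem_index_enum => /(_ isT).
by rewrite mulf_eq0 orbb => /eqP.
Qed.

Lemma enorm_sqr u : enorm u ^+ 2 = dotr u u.
Proof. by rewrite sqr_sqrtr// dotr_ge0. Qed.

Lemma cauchy_schwarz u v : dotr u v ^+ 2 <= dotr u u * dotr v v.
Proof.
have := dotr_ge0 v; rewrite le_eqVlt => /orP[/eqP v0|v0].
  have -> : v = 0 by apply: dotr_eq0.
  by rewrite -(scale0r 0) !dotrZr !mul0r mulr0 expr0n.
have := dotr_ge0 (dotr v v *: u + (- dotr u v) *: v).
rewrite !dotrDl !dotrDr !dotrZl !dotrZr (dotrC v u) => H.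
rewrite -subr_ge0 -(pmulr_rge0 _ v0); apply: le_trans H _.
by rewrite le_eqVlt; apply/orP; left; apply/eqP; ring.
Qed.

Lemma dotr_unit_norm_le1 u v : dotr u u = 1 -> dotr v v = 1 -> -1 <= dotr u v <= 1.
Proof.
move=> u1 v1; have := cauchy_schwarz u v; rewrite u1 v1 mulr1 => H.
by rewrite -ler_norml -(@expr_le1 _ 2)// -normrX ger0_norm ?sqr_ge0.
Qed.

Lemma acos_le (a b : R) : -1 <= a -> a <= b -> b <= 1 -> acos b <= acos a.
Proof.
move=> a1 ab b1.
have aI : -1 <= a <= 1 by rewrite a1 (le_trans ab).
have bI : -1 <= b <= 1 by rewrite b1 andbT (le_trans a1).
rewrite leNgt; apply/negP => H; move: ab; apply/negP; rewrite -ltNge.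
rewrite -(@acosK _ a) ?in_itv//= -(@acosK _ b) ?in_itv//=.
by rewrite ltr_cos// in_itv/= ?acos_ge0 ?acos_lepi.
Qed.

(** Cauchy-Schwarz for the components of u and x orthogonal to v, of norms sin a and
    sin b, gives (u, x) >= cos a cos b - sin a sin b = cos (a + b). *)
Lemma acos_dotr_triangle u v x : dotr u u = 1 -> dotr v v = 1 -> dotr x x = 1 ->
  acos (dotr u x) <= acos (dotr u v) + acos (dotr v x).
Proof.
move=> u1 v1 x1.
have uv := dotr_unit_norm_le1 u1 v1; have vx := dotr_unit_norm_le1 v1 x1.
have ux := dotr_unit_norm_le1 u1 x1.
set a := acos (dotr u v); set b := acos (dotr v x).
have a0 : 0 <= a by exact: acos_ge0.
have b0 : 0 <= b by exact: acos_ge0.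
have [abpi|/ltW piab] := leP (a + b) pi; last first.
  by apply: le_trans piab; exact: acos_lepi.
have cosa : cos a = dotr u v by rewrite acosK.
have cosb : cos b = dotr v x by rewrite acosK.
have sina : 0 <= sin a by rewrite sin_ge0_pi// a0 acos_lepi.
have sinb : 0 <= sin b by rewrite sin_ge0_pi// b0 acos_lepi.
rewrite -(@cosK _ (a + b)); last by rewrite in_itv/= addr_ge0.
apply: acos_le; [exact: cos_geN1| |by case/andP: ux].
have CS := cauchy_schwarz (u + (- dotr u v) *: v) (x + (- dotr v x) *: v).
move: CS; rewrite !(dotrDl, dotrDr, dotrZl, dotrZr) (dotrC v u) (dotrC x v).
rewrite u1 v1 x1 -cosa -cosb.
rewrite (_ : _ * (_ + _) = (sin a * sin b) ^+ 2); last first.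
  by rewrite exprMn !sin2cos2; ring.
rewrite (_ : _ + _ = dotr u x - cos a * cos b); last by ring.
rewrite -[X in X <= _]real_normK ?num_real// ler_pXn2r ?nnegrE ?mulr_ge0//.
rewrite ler_norml cosD => /andP[+ _]; lra.
Qed.

End dot_product.

(** * Even polynomials on the surface *)

Section even_polynomials.
Variables (R : realType) (d : nat) (vrho : R).
Implicit Types (x a e : 'rV[R]_d) (z : 'rV[R]_d * R) (f : 'rV[R]_d * R -> R).

(* The even part in t of t ^ k, rewritten by t ^ 2 = |x| ^ 2 + vrho ^ 2. *)
Let even_power (k : nat) x : R :=
  if odd k then 0 else (dotr x x + vrho ^+ 2) ^+ k./2.

Let monomial (m : multinom (d + 1)) x : R :=
  (\prod_(i < d) x ord0 i ^+ m (lshift 1 i)) * even_power (m (rshift d ord0)) x.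

Lemma measurable_dotr a : measurable_fun setT (fun x => dotr a x).
Proof.
rewrite (_ : (fun x => _) = fun x => \sum_i (a ord0 i * x ord0 i)); last first.
  by apply/funext => x; rewrite dotrE.
apply: measurable_sum => i.
by apply: measurable_funM => //; exact: measurable_coord.
Qed.

Lemma measurable_dotrr : measurable_fun setT (fun x => dotr x x).
Proof.
rewrite (_ : (fun x => _) = fun x => \sum_i (x ord0 i * x ord0 i)); last first.
  by apply/funext => x; rewrite dotrE.
apply: measurable_sum => i.
by apply: measurable_funM => //; exact: measurable_coord.
Qed.

Let measurable_monomial m : measurable_fun setT (monomial m).
Proof.
apply: measurable_funM.
  apply: (@measurable_prod _ _ _ _ _ _ (fun i x => x ord0 i ^+ m (lshift 1 i))) => i _.
  by apply: measurable_funX; exact: measurable_coord.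
rewrite /even_power; case: odd => //.
by apply: measurable_funX; apply: measurable_funD => //; exact: measurable_dotrr.
Qed.

Let monomial_bounded m x : dotr x x <= 1 ->
  `|monomial m x| <= (1 + vrho ^+ 2) ^+ (m (rshift d ord0))./2.
Proof.
move=> x1; rewrite /monomial normrM.
have c0 : 0 <= 1 + vrho ^+ 2 by rewrite addr_ge0// sqr_ge0.
rewrite -[leRHS]mul1r; apply: ler_pM => //.
  rewrite normr_prod; apply: prodr_ile1 => i _; rewrite normr_ge0/= normrX.
  apply: exprn_ile1 => //; rewrite -(@expr_le1 _ 2)// real_normK ?num_real//.
  apply: le_trans x1; rewrite dotrE (bigD1 i)//= -expr2 lerDl.
  by apply: sumr_ge0 => j _; rewrite -expr2 sqr_ge0.
rewrite /even_power; case: odd; first by rewrite normr0 exprn_ge0.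
have x0 := dotr_ge0 x.
rewrite normrX; apply: lerXn2r; rewrite ?nnegrE// ger0_norm ?lerD2r//.
by rewrite addr_ge0// sqr_ge0.
Qed.

Let monomial_trig N m a e : (mdeg m <= N)%N ->
  trigpoly N (fun t => monomial m (cos t *: a + sin t *: e)).
Proof.
move=> mN; pose g t : 'rV[R]_d := cos t *: a + sin t *: e.
have lin i : trigpoly 1 (fun t => g t ord0 i).
  apply: eq_trigpoly (trigpoly_linear (a ord0 i) (e ord0 i)) => t.
  by rewrite /g !mxE ![_ * cos t]mulrC ![_ * sin t]mulrC.
have sq : trigpoly 2 (fun t => dotr (g t) (g t) + vrho ^+ 2).
  apply: trigpolyD (trigpolyC _ _).
  have := @trigpoly_sum R 2 _ (index_enum 'I_d) (fun i t => g t ord0 i * g t ord0 i)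
    (fun i => trigpolyM (lin i) (lin i)).
  by apply: eq_trigpoly => t; rewrite dotrE.
have even_trig k : trigpoly k (fun t => even_power k (g t)).
  rewrite /even_power; have [ok|/negbTE ok] := boolP (odd k).
    exact: trigpoly0.
  apply: trigpoly_le (trigpolyX k./2 sq).
  by rewrite -[X in (_ <= X)%N]odd_double_half ok add0n muln2.
have prod_trig := @trigpoly_prod R _ (index_enum 'I_d)
  (fun i t => g t ord0 i ^+ m (lshift 1 i)) _
  (fun i => trigpolyX (m (lshift 1 i)) (lin i)).
apply: trigpoly_le (trigpolyM prod_trig (even_trig (m (rshift d ord0)))).
apply: leq_trans mN; rewrite mdegE big_split_ord/= big_ord1.
by rewrite leq_add2r; apply: leq_sum => i _; rewrite muln1.
Qed.

Lemma conic_opp x t : conic vrho (x, t) -> conic vrho (x, - t).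
Proof. by rewrite /conic/= sqrrN /heights/= normrN. Qed.

(** Averaging over t and -t removes the odd powers of t.  The even ones become
    polynomials in x of the same degree, so the degree along a circle does not
    exceed N. *)
Lemma even_polynomial_restriction N f : even_polynomials vrho N f ->
  exists q : 'rV[R]_d -> R,
  [/\ forall z, conic vrho z -> f z = q z.1,
      measurable_fun setT q,
      exists M, forall x, dotr x x <= 1 -> `|q x| <= M &
      forall a e, trigpoly N (fun t => q (cos t *: a + sin t *: e))].
Proof.
move=> [[P [PN fP]] fe].
exists (fun x => \sum_(m <- msupp P) mcoeff m P * monomial m x); split.
- move=> [x t] xt; have xt' := conic_opp xt.
  have -> : f (x, t) = (f (x, t) + f (x, - t)) / 2.
    by rewrite -(fe x t xt); field.
  rewrite !fP// !mevalE -big_split/= mulr_suml; apply: eq_bigr => m _.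
  rewrite -mulrDr -mulrA; congr (_ * _).
  rewrite !big_split_ord/= !big_ord1.
  have E s : \prod_(i < d) row_mx x (s%:M : 'rV_1) ord0 (lshift 1 i) ^+ m (lshift 1 i)
     = \prod_(i < d) x ord0 i ^+ m (lshift 1 i).
    by apply: eq_bigr => i _; rewrite row_mxEl.
  rewrite !E -mulrDr -mulrA /monomial; congr (_ * _).
  rewrite !row_mxEr !mxE eqxx !mulr1n /even_power.
  set k := m _.
  have x2 : dotr x x + vrho ^+ 2 = t ^+ 2.
    by case: xt => /= xt _; rewrite -enorm_sqr xt subrK.
  rewrite x2 exprNn -signr_odd; case: ifP => ok.
    by rewrite expr1 mulN1r subrr mul0r.
  rewrite expr0 mul1r -exprM mul2n -[in LHS](odd_double_half k) ok add0n.
  by field.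
- apply: measurable_sum => m; apply: measurable_funM => //.
- exists (\sum_(m <- msupp P) `|mcoeff m P| * (1 + vrho ^+ 2) ^+ (m (rshift d ord0))./2).
  move=> x x1; apply: le_trans (ler_norm_sum _ _ _) _; apply: ler_sum => m _.
  by rewrite normrM ler_wpM2l// monomial_bounded.
- move=> a e.
  have [s sP] : exists s : seq (multinom (d + 1)), s = msupp P by exists (msupp P).
  have : {in s, forall m, (mdeg m <= N)%N}.
    move=> m; rewrite sP => /msize_mdeg_lt mP.
    by rewrite -ltnS; exact: leq_trans PN.
  rewrite -sP {sP}; elim: s => [_|m s IH sN].
    by apply: eq_trigpoly (trigpoly0 _ _) => t; rewrite big_nil.
  have H1 := trigpolyZ (mcoeff m P) (monomial_trig a e (sN m (mem_head _ _))).
  have H2 : trigpoly N (fun t => \sum_(m <- s) mcoeff m P *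
      monomial m (cos t *: a + sin t *: e)).
    by apply: IH => k ks; apply: sN; rewrite inE ks orbT.
  by apply: eq_trigpoly (trigpolyD H1 H2) => t; rewrite big_cons.
Qed.

End even_polynomials.

(** * The surface as a hemisphere *)

Section hemisphere.
Variables (R : realType) (d : nat) (vrho : R).
Hypothesis vrho0 : 0 <= vrho.
Implicit Types (x a e : 'rV[R]_d) (y z u : 'rV[R]_d * R) (f : 'rV[R]_d * R -> R).

(** Each part of the surface becomes the closed upper half of the unit sphere of
    R^(d + 1), and [conic_dist] the geodesic distance. *)
Definition hemi (z : 'rV[R]_d * R) : 'rV[R]_(d + 1) :=
  row_mx z.1 (Num.sqrt (1 + vrho ^+ 2 - z.2 ^+ 2))%:M.

Lemma dotr_row_mx x a (s t : R) :
  dotr (row_mx x (s%:M : 'rV_1)) (row_mx a (t%:M : 'rV_1)) = dotr x a + s * t.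
Proof.
rewrite !dotrE big_split_ord/= big_ord1; congr (_ + _).
  by apply: eq_bigr => i _; rewrite !row_mxEl.
by rewrite !row_mxEr !mxE eqxx !mulr1n.
Qed.

Lemma conic_distE y z : conic_dist vrho y z = acos (dotr (hemi y) (hemi z)).
Proof. by rewrite dotr_row_mx. Qed.

Lemma conic_sqr_le z : conic vrho z -> z.2 ^+ 2 <= 1 + vrho ^+ 2.
Proof.
move=> [_ /andP[_ H]]; rewrite -(real_normK (num_real z.2)).
rewrite -[leRHS](sqr_sqrtr (_ : 0 <= _)); last by rewrite addr_ge0// sqr_ge0.
by rewrite addrC; apply: lerXn2r; rewrite ?nnegrE ?sqrtr_ge0.
Qed.

Lemma hemi_unit z : conic vrho z -> dotr (hemi z) (hemi z) = 1.
Proof.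
move=> cz; rewrite dotr_row_mx -expr2 sqr_sqrtr ?subr_ge0 ?conic_sqr_le//.
by case: cz => + _; rewrite enorm_sqr => ->; ring.
Qed.

(** The upper part for [true], the lower part for [false]; if the two parts meet,
    that is, if vrho = 0, the whole surface is put into the former, so that any
    two points of a [part] are in the relation [same_part], and no others are. *)
Definition part (b : bool) : set ('rV[R]_d * R) :=
  [set z | conic vrho z /\
    if b then vrho = 0 \/ 0 <= z.2 else vrho != 0 /\ z.2 < 0].

Lemma part_conic b : part b `<=` conic vrho.
Proof. by move=> z []. Qed.

Lemma conic_part z : conic vrho z -> part true z \/ part false z.
Proof.
move=> cz; have [r0|r0] := eqVneq vrho 0; first by left; split => //; left.
have [z0|z0] := leP 0 z.2; first by left; split => //; right.
by right.
Qed.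

Lemma part_disjoint z : part true z -> part false z -> False.
Proof.
move=> [_ zt] [_ [/eqP r0 zf]]; case: zt => // z0.
by move: zf; rewrite ltNge z0.
Qed.

Lemma conic_ballE b z r : part b z ->
  conic_ball vrho z r = dball (part b) (conic_dist vrho) z r.
Proof.
move=> pz; apply/seteqP; split => y.
  move=> [cy zy yr]; split => //; split => //.
  have [cz] := pz; have [_ /andP[rz _]] := cz; have [_ /andP[ry _]] := cy.
  have [r0|r0] := eqVneq vrho 0.
    by case: (b) => [_|[/eqP]]; first by left.
  have rp : 0 < vrho by rewrite lt_neqAle eq_sym r0.
  case: b {pz} => [[/eqP|z0]|[_ z0]]; first by rewrite (negbTE r0).
    case: zy => [/eqP|[]//|[z0' _]]; [by rewrite (negbTE r0)|by right|].
    have z00 : z.2 = 0 by apply/eqP; rewrite eq_le z0 z0'.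
    by move: rz; rewrite z00 normr0 leNgt rp.
  split => //; case: zy => [/eqP|[z0' _]|[_ y0]]; first by rewrite (negbTE r0).
    by move: z0; rewrite ltNge z0'.
  rewrite lt_neqAle y0 andbT; apply/eqP => y00.
  by move: ry; rewrite y00 normr0 leNgt rp.
move=> [[cy by_] yr]; split => //.
case: b pz by_ => [[_ zb] yb|[_ [_ zb]] [_ yb]].
  case: zb => [r0|z0]; first exact: Or31.
  by case: yb => [r0|y0]; [exact: Or31|exact: Or32].
by apply: Or33; split; exact: ltW.
Qed.

Lemma part_dist_ge0 b y z : part b y -> part b z -> 0 <= conic_dist vrho y z.
Proof.
move=> /part_conic cy /part_conic cz; rewrite conic_distE acos_ge0//.
by apply: dotr_unit_norm_le1; exact: hemi_unit.
Qed.

Lemma part_distxx b y : part b y -> conic_dist vrho y y = 0.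
Proof. by move=> /part_conic cy; rewrite conic_distE hemi_unit// acos1. Qed.

Lemma part_distC b y z : part b y -> part b z ->
  conic_dist vrho y z = conic_dist vrho z y.
Proof. by rewrite !conic_distE dotrC. Qed.

Lemma part_dist_triangle b y z u : part b y -> part b z -> part b u ->
  conic_dist vrho y u <= conic_dist vrho y z + conic_dist vrho z u.
Proof.
move=> /part_conic cy /part_conic cz /part_conic cu; rewrite !conic_distE.
by apply: acos_dotr_triangle; exact: hemi_unit.
Qed.

Lemma part_dist_le4 b y z : part b y -> part b z -> conic_dist vrho y z <= 4.
Proof.
move=> /part_conic cy /part_conic cz; rewrite conic_distE.
apply: (@le_trans _ _ pi).
  by rewrite acos_lepi// dotr_unit_norm_le1//; exact: hemi_unit.
have := @pihalf_lt2 R; lra.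
Qed.

Lemma measurable_part b : measurable (part b).
Proof.
have mc : measurable (conic vrho : set ('rV[R]_d * R)).
  have -> : conic vrho =
      (fun z : 'rV[R]_d * R => enorm z.1 ^+ 2 - (z.2 ^+ 2 - vrho ^+ 2)) @^-1`
        [set 0] `&` (fun z => `|z.2|) @^-1` `[vrho, Num.sqrt (vrho ^+ 2 + 1)].
    apply/seteqP; split => z; rewrite /conic /heights/= in_itv/=.
      by move=> [-> ->]; rewrite subrr.
    by move=> [/eqP + ->]; rewrite subr_eq0 => /eqP.
  apply: measurableI; rewrite -[X in measurable X]setTI.
    have mg : measurable_fun setT
        (fun z : 'rV[R]_d * R => enorm z.1 ^+ 2 - (z.2 ^+ 2 - vrho ^+ 2)).
      apply: measurable_funB.
        apply: measurable_funX.
        exact: (measurableT_comp (@measurable_enorm R d) measurable_fst).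
      by apply: measurable_funB => //; apply: measurable_funX; exact: measurable_snd.
    exact: mg.
  have mg : measurable_fun setT (fun z : 'rV[R]_d * R => `|z.2|).
    exact: (measurableT_comp (@normr_measurable R setT) measurable_snd).
  exact: mg.
have ms (A : set R) : measurable A -> measurable ((@snd 'rV[R]_d R) @^-1` A).
  by move=> mA; rewrite -[X in measurable X]setTI; exact: measurable_snd.
have [r0|r0] := eqVneq vrho 0; case: b.
- rewrite (_ : part true = conic vrho)//.
  by apply/seteqP; split => z; [move=> []|split => //; left].
- rewrite (_ : part false = set0)//.
  by apply/seteqP; split => z //; move=> [_ [/eqP]].
- rewrite (_ : part true = conic vrho `&` snd @^-1` `[0, +oo[).
    by apply: measurableI => //; exact: ms.
  apply/seteqP; split => z; rewrite /part/= in_itv/= andbT.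
    by move=> [cz [/eqP|//]]; rewrite (negbTE r0).
  by move=> [cz z0]; split => //; right.
- rewrite (_ : part false = conic vrho `&` snd @^-1` `]-oo, 0[).
    by apply: measurableI => //; exact: ms.
  apply/seteqP; split => z; rewrite /part/= in_itv/=.
    by move=> [cz [_ z0]].
  by move=> [cz z0].
Qed.

Lemma measurable_part_ball b z r : part b z ->
  measurable (dball (part b) (conic_dist vrho) z r).
Proof.
move=> pz; have cz := part_conic pz.
have [r0|r0] := ltP r 0.
  rewrite (_ : dball _ _ _ _ = set0)//; apply/seteqP; split => y //= [py].
  by move=> yr; have := part_dist_ge0 pz py; rewrite leNgt (le_lt_trans yr).
have [rpi|pir] := leP r pi; last first.
  rewrite (_ : dball _ _ _ _ = part b); first exact: measurable_part.
  apply/seteqP; split => y; first by case.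
  move=> py; split => //; apply: le_trans (ltW pir); rewrite conic_distE.
  rewrite acos_lepi// dotr_unit_norm_le1//; apply: hemi_unit => //.
  exact: part_conic py.
rewrite (_ : dball _ _ _ _ = part b `&`
   (fun y => dotr (hemi z) (hemi y)) @^-1` `[cos r, +oo[).
  apply: measurableI; first exact: measurable_part.
  rewrite -[X in measurable X]setTI.
  have mg : measurable_fun setT (fun y => dotr (hemi z) (hemi y)).
    rewrite (_ : (fun y => _) = fun y => dotr z.1 y.1 +
      Num.sqrt (1 + vrho ^+ 2 - z.2 ^+ 2) * Num.sqrt (1 + vrho ^+ 2 - y.2 ^+ 2)).
      apply: measurable_funD.
        exact: (measurableT_comp (measurable_dotr z.1) measurable_fst).
      apply: measurable_funM => //.
      apply: (@measurableT_comp _ _ _ _ _ _ (@Num.sqrt R)).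
        by apply: continuous_measurable_fun; exact: sqrt_continuous.
      by apply: measurable_funB => //; apply: measurable_funX; exact: measurable_snd.
    by apply/funext => y; rewrite dotr_row_mx.
  exact: mg.
apply/seteqP; split => y; rewrite /dball/= in_itv/= andbT => -[py H]; split => //.
  have I := dotr_unit_norm_le1 (hemi_unit cz) (hemi_unit (part_conic py)).
  rewrite -(@acosK _ (dotr _ _)) ?in_itv//= -conic_distE.
  rewrite leNgt ltr_cos ?in_itv/= ?r0//; first by rewrite -leNgt.
  by rewrite conic_distE acos_ge0 ?acos_lepi.
rewrite conic_distE -(@cosK _ r) ?in_itv/= ?r0//.
have /andP[_ I] := dotr_unit_norm_le1 (hemi_unit cz) (hemi_unit (part_conic py)).
by apply: acos_le => //; exact: cos_geN1.
Qed.

End hemisphere.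

(** * Localized Bernstein inequality on the surface *)

Section great_circles.
Variables (R : realType) (d : nat) (vrho : R).
Hypothesis vrho0 : 0 <= vrho.
Implicit Types (x a e : 'rV[R]_d) (y z u : 'rV[R]_d * R) (f : 'rV[R]_d * R -> R).

(** A unit vector (x, s) of R^(d + 1) is represented in any part by the point that
    lies over x.  If s < 0 this point corresponds to the mirror image (x, -s),
    which is closer to every point of the upper half of the sphere. *)
Lemma part_point b y x (s : R) : part vrho b y -> dotr x x + s ^+ 2 = 1 ->
  exists z, [/\ part vrho b z, z.1 = x &
    conic_dist vrho y z <= acos (dotr (hemi vrho y) (row_mx x (s%:M : 'rV_1)))].
Proof.
move=> py xs1; have x0 := dotr_ge0 x; have s0 := sqr_ge0 s.
have r0 := sqr_ge0 vrho.
pose t := Num.sqrt (dotr x x + vrho ^+ 2).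
have t0 : 0 <= t by exact: sqrtr_ge0.
have t2 : t ^+ 2 = dotr x x + vrho ^+ 2 by rewrite sqr_sqrtr// addr_ge0.
pose z : 'rV[R]_d * R := (x, if b then t else - t).
have z2 : z.2 ^+ 2 = dotr x x + vrho ^+ 2.
  by rewrite /z/=; case: b {py z}; rewrite ?sqrrN.
have zn : `|z.2| = t by rewrite /z/=; case: b {py z z2}; rewrite ?normrN ger0_norm.
have rt : vrho <= t.
  by rewrite -[X in X <= _](ger0_norm vrho0) -sqrtr_sqr ler_wsqrtr// lerDr.
have cz : conic vrho z.
  split; first by rewrite enorm_sqr z2 /= addrK.
  rewrite /heights/= zn rt/= ler_wsqrtr// addrC lerD2l.
  by rewrite -xs1 lerDl.
exists z; split => //.
  split => //; rewrite /z/=; case: b py {z z2 zn cz}; first by right.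
  move=> [_ [r00 _]]; split => //; rewrite oppr_lt0; apply: lt_le_trans rt.
  by rewrite lt_neqAle eq_sym r00.
have hz : hemi vrho z = row_mx x (`|s|%:M : 'rV_1).
  rewrite /hemi z2; congr (row_mx _ _%:M); rewrite -sqrtr_sqr; congr Num.sqrt.
  by rewrite -xs1; ring.
have cy := part_conic py; have hy := hemi_unit cy.
have unit_s : dotr (row_mx x (s%:M : 'rV_1)) (row_mx x (s%:M : 'rV_1)) = 1.
  by rewrite dotr_row_mx -expr2.
rewrite conic_distE hz; apply: acos_le.
- by have /andP[] := dotr_unit_norm_le1 hy unit_s.
- by rewrite !dotr_row_mx lerD2l ler_wpM2l ?sqrtr_ge0// ler_norm.
- by rewrite -hz; have /andP[] := dotr_unit_norm_le1 hy (hemi_unit cz).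
Qed.

Definition local_const (J B : nat) : R := (J + B)%:R * 3 ^+ B + B%:R * 2 ^+ B.

(** [local_bernstein] on the great circle through y and u.  By [part_point] the value
    of q at angle t on that circle is the value of f at a point at distance at
    most [acos (cos t)] from y. *)
Theorem conic_local_bernstein J n B b f : (0 < n)%N -> (0 < B)%N ->
  even_polynomials vrho (J * n) f ->
  forall y u (A : R), part vrho b y -> part vrho b u -> 0 <= A ->
  (forall v, part vrho b v ->
     `|f v| <= A * (1 + conic_dist vrho y v / n%:R^-1) ^+ B) ->
  conic_dist vrho y u <= n%:R^-1 ->
  `|f u - f y| <= local_const J B * (conic_dist vrho y u / n%:R^-1) * A.
Proof.
move=> n0 B0 fe y u A py pu A0 fA yu.
have [q [fq _ _ qtrig]] := even_polynomial_restriction fe.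
have cy := part_conic py; have cu := part_conic pu.
have hy := hemi_unit cy; have hu := hemi_unit cu.
rewrite invrK in fA *; set th := conic_dist vrho y u in yu *.
have th0 : 0 <= th by exact: part_dist_ge0 py pu.
have n0' : 0 < n%:R :> R by rewrite ltr0n.
have nth : n%:R * th <= 1 by rewrite mulrC -ler_pdivlMr// mul1r.
have costh : cos th = dotr (hemi vrho y) (hemi vrho u).
  by rewrite /th conic_distE acosK// in_itv/= dotr_unit_norm_le1.
have C0 : 0 <= local_const J B :> R.
  by rewrite addr_ge0// mulr_ge0// exprn_ge0.
move: th0; rewrite le_eqVlt => /orP[/eqP th0|th0].
  have H : hemi vrho u = hemi vrho y.
    apply/eqP; rewrite -subr_eq0 -scaleN1r; apply/eqP/dotr_eq0.
    rewrite !(dotrDl, dotrDr, dotrZl, dotrZr) hy hu (dotrC _ (hemi vrho y)).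
    by rewrite -costh -th0 cos0; ring.
  have -> : f u = f y.
    rewrite !fq//; have := congr1 lsubmx H.
    by rewrite /hemi !row_mxKl => ->.
  by rewrite subrr normr0 !mulr_ge0// -th0.
have thpi : th < pi.
  apply: (@le_lt_trans _ _ 1); last by have := @pi_ge2 R; lra.
  by apply: le_trans yu _; rewrite invf_le1// ler1n.
have sth : 0 < sin th by rewrite sin_gt0_pi// th0.
(* the unit tangent vector at y in the direction of u *)
pose e : 'rV[R]_(d + 1) :=
  (sin th)^-1 *: (hemi vrho u + (- cos th) *: hemi vrho y).
have ye : dotr (hemi vrho y) e = 0.
  by rewrite /e !(dotrDr, dotrZr) hy -costh; ring.
have ee : dotr e e = 1.
  rewrite /e !(dotrDl, dotrDr, dotrZl, dotrZr) hy hu (dotrC _ (hemi vrho y)) -costh.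
  transitivity ((1 - cos th ^+ 2) / (sin th ^+ 2)).
    by field; rewrite gt_eqF.
  by rewrite -sin2cos2 divff// expf_neq0// gt_eqF.
have eE : e = (sin th)^-1 *: (hemi vrho u + (- cos th) *: hemi vrho y) by [].
clearbody e.
pose g t := cos t *: hemi vrho y + sin t *: e.
have gg t : dotr (g t) (g t) = 1.
  rewrite /g !(dotrDl, dotrDr, dotrZl, dotrZr) hy ee (dotrC e) ye.
  by rewrite -[RHS](cos2Dsin2 t); ring.
have yg t : dotr (hemi vrho y) (g t) = cos t.
  by rewrite /g !(dotrDr, dotrZr) hy ye; ring.
pose T t := q (cos t *: y.1 + sin t *: lsubmx e).
have Tg t : T t = q (lsubmx (g t)).
  by rewrite /T /g linearD !linearZ /= /hemi row_mxKl.
have TA t : `|T t| <= A * (1 + n%:R * acos (cos t)) ^+ B.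
  pose s := g t ord0 (rshift d ord0).
  have gE : g t = row_mx (lsubmx (g t)) (s%:M : 'rV_1).
    rewrite -[LHS]hsubmxK; congr row_mx; apply/rowP => i.
    by rewrite !ord1 [LHS]mxE [RHS]mxE eqxx mulr1n.
  have := gg t; rewrite {1 2}gE dotr_row_mx -expr2 => gs.
  have [z [pz zg yz]] := part_point py gs.
  rewrite Tg -zg -fq; last exact: part_conic pz.
  apply: le_trans (fA z pz) _; rewrite ler_wpM2l//.
  have yz0 := part_dist_ge0 py pz.
  rewrite -gE yg in yz.
  apply: lerXn2r; rewrite ?nnegrE ?addr_ge0 ?mulr_ge0 ?acos_cos_ge0//.
  by rewrite lerD2l mulrC ler_wpM2l.
have := local_bernstein n0 B0 (qtrig y.1 (lsubmx e)) A0 TA.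
move=> /(_ th); rewrite ger0_norm ?(ltW th0)// => /(_ nth).
have -> : q (cos th *: y.1 + sin th *: lsubmx e) = f u.
  rewrite fq//; congr q.
  have -> : lsubmx e = (sin th)^-1 *: (u.1 + (- cos th) *: y.1).
    by rewrite eE linearZ/= linearD/= linearZ/= /hemi !row_mxKl.
  by rewrite scalerA divff ?gt_eqF// scale1r addrC scaleNr subrK.
have -> : q (cos 0 *: y.1 + sin 0 *: lsubmx e) = f y.
  by rewrite cos0 sin0 scale1r scale0r addr0 fq.
by rewrite [th * _]mulrC.
Qed.

End great_circles.

(** * The constants *)

Section constants.
Variable R : realType.

Lemma powR_ge_root (x q p : R) : 1 <= x -> 0 < q -> q <= p ->
  x <= (x `^ q^-1) `^ p.
Proof.
move=> x1 q0 qp; rewrite -powRrM; apply: le1r_powR => //.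
by rewrite mulrC ler_pdivlMr// mul1r.
Qed.

Lemma powR_le_root (x q p : R) : 0 < x -> x <= 1 -> 0 < q -> q <= p ->
  (x `^ q^-1) `^ p <= x.
Proof.
move=> x0 x1 q0 qp.
have := @powR_ge_root x^-1 q p; rewrite invf_ge1// => /(_ x1 q0 qp).
have -> : (x^-1 `^ q^-1) `^ p = ((x `^ q^-1) `^ p)^-1.
  by rewrite -powR_inv1 ?(ltW x0)// -!powRrM -powRN; congr (_ `^ _); ring.
by rewrite lef_pV2// posrE !powR_gt0.
Qed.

Definition upper_const (B j : nat) (L p : R) : R :=
  (2 ^+ B) `^ p * (2 * fstar_const L B p j * L ^+ 3).

(** Everything is uniform in p >= q: B is chosen such that 2 L <= 2 ^ (B q), then j
    such that 2 ^ -j is small compared to the constant for that B, and the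
    factors of [upper_const] that are not p-th powers are bounded by p-th powers
    of their q-th roots. *)
Lemma exists_constants J (L q : R) : 1 <= L -> 0 < q ->
  exists B j K, [/\ (0 < B)%N, local_const R J B <= 2 ^+ j / 2, 0 < K &
    forall p, q <= p -> 2 * L <= (2 ^+ B) `^ p /\ upper_const B j L p <= K `^ p].
Proof.
move=> L1 q0; have L0 : 0 < L by exact: lt_le_trans L1.
pose x := (2 * L) `^ q^-1; have x0 : 0 <= x by exact: powR_ge0.
have [b [xb _]] := exists_pow2_between x0.
pose B := b.+1.
have xB : x <= 2 ^+ B.
  by apply: le_trans xb _; rewrite /B exprS ler_peMl// ?exprn_ge0// ler1n.
have C0 : 0 <= local_const R J B.
  by rewrite addr_ge0// mulr_ge0// exprn_ge0.
have [j [Cj _]] := exists_pow2_between (mulr_ge0 (ler0n R 2) C0).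
have B0 : 0 < 2 ^+ B :> R by rewrite exprn_gt0.
have L60 : 1 <= 2 * L ^+ (3 + j + 3).
  by rewrite -[leLHS]mulr1; apply: ler_pM => //; rewrite ?ler1n// exprn_ege1.
pose K := 2 ^+ B * (4 * 2 ^+ B) * (2 * L ^+ (3 + j + 3)) `^ q^-1.
exists B, j, K; split => //.
- by rewrite ler_pdivlMr// mulrC.
- by rewrite !mulr_gt0// powR_gt0// (lt_le_trans _ L60).
move=> p qp; have p0 : 0 < p by exact: lt_le_trans qp.
split.
  apply: (@le_trans _ _ (x `^ p)).
    by apply: powR_ge_root => //; lra.
  by apply: (ge0_ler_powR (ltW p0)); rewrite ?nnegrE// ltW.
rewrite /K powRM; [|by rewrite !mulr_ge0// ltW|exact: powR_ge0].
rewrite powRM; [|exact: ltW|by rewrite mulr_ge0// ltW].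
rewrite /upper_const /fstar_const.
rewrite (_ : _ * _ = (2 ^+ B) `^ p * (4 * 2 ^+ B) `^ p *
    (2 * L ^+ (3 + j + 3))); last first.
  by rewrite [L ^+ (3 + j + 3)]exprD; ring.
by rewrite ler_wpM2l ?mulr_ge0 ?powR_ge0// powR_ge_root.
Qed.

End constants.

(** * Marcinkiewicz-Zygmund inequalities on the surface *)

Section conic_inequalities.
Variables (R : realType) (d : nat) (vrho : R).
Hypothesis vrho0 : 0 <= vrho.
Implicit Types (w f : 'rV[R]_d * R -> R) (Xi : set ('rV[R]_d * R)).

Lemma even_polynomials_le N M f : (N <= M)%N ->
  even_polynomials vrho N f -> even_polynomials vrho M f.
Proof.
move=> NM [[P [PN fP]] fe]; split => //; exists P; split => //.
exact: leq_trans PN _.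
Qed.

Lemma doubling_bound_le w L L' : weight vrho w -> L <= L' ->
  doubling_bound vrho w L -> doubling_bound vrho w L'.
Proof.
move=> [_ w0] LL' [L0 wL]; split; first exact: lt_le_trans LL'.
move=> z r cz r0; apply: le_trans (wL z r cz r0) _.
apply: lee_wpmul2r; last by rewrite lee_fin.
by apply: integral_ge0 => y [cy _ _]; rewrite lee_fin w0.
Qed.

(** Adding 1 avoids the question whether the infimum is attained, which fails for a
    weight whose balls have mass 0 or +oo: all L > 0 are then bounds, and the
    infimum is 0. *)
Lemma doubling_constant_bound w : weight vrho w -> doubling vrho w ->
  doubling_bound vrho w (Num.max 1 (doubling_constant vrho w + 1)).
Proof.
move=> ww [L HL].
have [||l Hl lL] := @inf_adherent R [set L | doubling_bound vrho w L] 1.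
- by [].
- by split; [exists L|exists 0 => l [/ltW]].
by apply: doubling_bound_le Hl => //; rewrite le_max (ltW lL) orbT.
Qed.

Section fixed_data.
Variables (w f : 'rV[R]_d * R -> R) (L p : R) (J n B j : nat).
Hypothesis ww : weight vrho w.
Hypothesis wL : doubling_bound vrho w L.
Hypothesis L1 : 1 <= L.
Hypothesis n0 : (0 < n)%N.
Hypothesis B0 : (0 < B)%N.
Hypothesis fe : even_polynomials vrho (J * n) f.
Hypothesis Cj : local_const R J B <= 2 ^+ j / 2.
Hypothesis p0 : 0 < p.
Hypothesis Bp : 2 * L <= (2 ^+ B) `^ p.
Variables (eps : R) (Xi : set ('rV[R]_d * R)).
Hypothesis eps0 : 0 < eps.
Hypothesis XiC : Xi `<=` conic vrho.
Hypothesis Xisep : Defs.separated vrho eps Xi.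

Let mw b : measurable_fun (part vrho b) w.
Proof.
apply: measurable_funS (@part_conic _ _ _ b) ww.1.
have -> : conic vrho = part vrho true `|` part vrho false :> set ('rV[R]_d * R).
  apply/seteqP; split => z; first by move=> /conic_part[]; [left|right].
  by case=> /part_conic.
by apply: measurableU; exact: measurable_part.
Qed.

Let w0 b z : part vrho b z -> 0 <= w z.
Proof. by move=> /part_conic cz; exact: ww.2. Qed.

Let doub b z r : part vrho b z -> 0 < r ->
  (mass (surface_measure vrho) w
     (dball (part vrho b) (conic_dist vrho) z (2 * r)) <=
   L%:E * mass (surface_measure vrho) w
     (dball (part vrho b) (conic_dist vrho) z r))%E.
Proof.
move=> pz r0; rewrite -!conic_ballE//.
by apply: wL.2 => //; exact: part_conic pz.
Qed.

Let h0 : 0 < n%:R^-1 :> R. Proof. by rewrite invr_gt0 ltr0n. Qed.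

Let C0 : 0 <= local_const R J B.
Proof. by rewrite addr_ge0// mulr_ge0// exprn_ge0. Qed.

Let mf b : measurable_fun (part vrho b) f.
Proof.
have [q [fq mq _ _]] := even_polynomial_restriction fe.
have mq' : measurable_fun (part vrho b) (fun z => q z.1).
  apply: measurable_funTS; exact: (measurableT_comp mq measurable_fst).
apply: eq_measurable_fun mq' => z; rewrite inE => /part_conic cz.
by rewrite fq.
Qed.

Let f_bounded : exists M : R, forall b z, part vrho b z -> `|f z| <= M.
Proof.
have [q [fq _ [M qM] _]] := even_polynomial_restriction fe.
exists M => b z /part_conic cz; rewrite fq//; apply: qM.
rewrite -enorm_sqr; case: (cz) => -> _.
by have := conic_sqr_le cz; lra.
Qed.

Let part_separated b x y : (Xi `&` part vrho b) x -> (Xi `&` part vrho b) y ->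
  x <> y -> eps <= conic_dist vrho x y.
Proof.
move=> [Xx px] [Xy py] xy; apply: Xisep => //.
have : conic_ball vrho x 4 y.
  by rewrite (conic_ballE vrho0 _ px); split => //; exact: part_dist_le4 px py.
by case.
Qed.

Lemma part_sum_sup_le b : eps <= n%:R^-1 ->
  (\esum_(z in Xi `&` part vrho b)
     (ereal_sup [set (`|f y| `^ p)%:E | y in conic_ball vrho z eps] *
      weighted_measure vrho w (conic_ball vrho z eps)) <=
   (upper_const B j L p)%:E *
   \int[surface_measure vrho]_(z in part vrho b) (`|f z| `^ p * w z)%:E)%E.
Proof.
move=> epsn; have [M fM] := f_bounded.
apply: ge_ereal_sup => _ [F [finF FXi] <-].
rewrite fsbig_finite//=.
have FP x : x \in finmap.enum_fset (fset_set F) -> (Xi `&` part vrho b) x.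
  by rewrite in_fset_set// inE => /FXi.
have sF : separated_seq (part vrho b) (conic_dist vrho) eps
    (finmap.enum_fset (fset_set F)).
  split; first exact: finmap.fset_uniq.
    by move=> x /FP[].
  by move=> x y xF yF /eqP xy; apply: part_separated xy; exact: FP.
rewrite [leLHS]big_seq.
under eq_bigr => x /FP[_ px] do rewrite (conic_ballE vrho0 _ px).
rewrite -big_seq.
exact: (sum_sup_le (measurable_part vrho b) (@part_dist_ge0 _ _ _ b)
  (@part_distxx _ _ _ b) (@part_distC _ _ _ b) (@part_dist_triangle _ _ _ b)
  (@part_dist_le4 _ _ _ b) (@measurable_part_ball _ _ _ b) (@mw b) (@w0 b) L1
  (@doub b) h0 C0 (@mf b) (fM b) (conic_local_bernstein vrho0 n0 B0 fe (b := b)) p0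
  Cj Bp eps0 epsn sF).
Qed.

Lemma part_le_sum_inf b del : eps <= del * n%:R^-1 -> 0 <= del <= 1 ->
  (4 * local_const R J B * del) `^ p * upper_const B j L p <= 1 / 2 ->
  2 * del <= (2 ^+ j)^-1 ->
  (forall y, conic vrho y -> exists2 z, Xi z & conic_ball vrho z eps y) ->
  (\int[surface_measure vrho]_(z in part vrho b) (`|f z| `^ p * w z)%:E <=
   (2 * 2 `^ p)%:E * \esum_(z in Xi `&` part vrho b)
     (ereal_inf [set (`|f y| `^ p)%:E | y in conic_ball vrho z eps] *
      weighted_measure vrho w (conic_ball vrho z eps)))%E.
Proof.
move=> epsdel del01 small delj cov; have [M fM] := f_bounded.
rewrite [X in (_ <= _ * X)%E](_ : _ = \esum_(z in Xi `&` part vrho b)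
     (ereal_inf [set (`|f y| `^ p)%:E |
        y in dball (part vrho b) (conic_dist vrho) z eps] *
      mass (surface_measure vrho) w
        (dball (part vrho b) (conic_dist vrho) z eps)))%E; last first.
  by apply: eq_esum => z [_ pz]; rewrite (conic_ballE vrho0 _ pz).
have small' : (4 * local_const R J B * del) `^ p * (2 * fstar_const L B p j * L ^+ 3)
    <= 1 / 2.
  apply: le_trans small; rewrite ler_wpM2l ?powR_ge0//.
  have L0 : 0 <= L by exact: le_trans L1.
  rewrite /upper_const; apply: ler_peMl; last first.
    by apply: le_trans Bp; apply: le_trans L1 _; rewrite ler_peMl// ler1n.
  apply: mulr_ge0; last exact: exprn_ge0.
  by rewrite mulr_ge0// mulr_ge0 ?powR_ge0 ?exprn_ge0.
apply: (energy_le_sum_inf (measurable_part vrho b) (@part_dist_ge0 _ _ _ b)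
  (@part_distxx _ _ _ b) (@part_distC _ _ _ b) (@part_dist_triangle _ _ _ b)
  (@part_dist_le4 _ _ _ b) (@measurable_part_ball _ _ _ b) (@mw b) (@w0 b) L1
  (@doub b) h0 C0 (@mf b) (fM b) (conic_local_bernstein vrho0 n0 B0 fe (b := b)) p0
  Cj Bp eps0 epsdel del01 small' delj).
- by move=> x [].
- exact: part_separated.
move=> y py; have [z Xz zy] := cov y (part_conic py).
have cz := XiC Xz.
have [b' pz] : exists b', part vrho b' z.
  by case: (conic_part cz) => ?; [exists true|exists false].
move: zy; rewrite (conic_ballE vrho0 _ pz) => zy.
have bb' : b' = b.
  case: zy => + _; case: b' b {pz} py => -[]// p1 p2; exfalso;
    exact: part_disjoint p1 p2 || exact: part_disjoint p2 p1.
by exists z; rewrite -bb'.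
Qed.

Lemma integral_conic :
  (\int[surface_measure vrho]_(z in conic vrho) (`|f z| `^ p * w z)%:E =
   \int[surface_measure vrho]_(z in part vrho true) (`|f z| `^ p * w z)%:E +
   \int[surface_measure vrho]_(z in part vrho false) (`|f z| `^ p * w z)%:E)%E.
Proof.
have cE : conic vrho = part vrho true `|` part vrho false :> set ('rV[R]_d * R).
  apply/seteqP; split => z; first by move=> /conic_part[]; [left|right].
  by case=> /part_conic.
rewrite cE ge0_integral_setU//; try exact: measurable_part.
- apply/measurable_EFinP.
  by apply/measurable_funU; [exact: measurable_part|exact: measurable_part|split;
    exact: measurable_fpow].
- move=> z pz; have {pz} [b pz] : exists b, part vrho b z.
    by case: pz => ?; [exists true|exists false].
  by rewrite lee_fin mulr_ge0 ?powR_ge0// (w0 pz).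
- by apply/disj_setPS => z [] p1 p2; exact: part_disjoint p1 p2.
Qed.

Lemma esum_conic (g : 'rV[R]_d * R -> \bar R) : (forall z, Xi z -> 0 <= g z)%E ->
  (\esum_(z in Xi) g z = \esum_(z in Xi `&` part vrho true) g z +
   \esum_(z in Xi `&` part vrho false) g z)%E.
Proof.
move=> g0; rewrite (esumID (part vrho true))//; congr (_ + _)%E.
congr esum; apply/seteqP; split => z [Xz pz]; split => //.
  by case: (conic_part (XiC Xz)).
by move=> p1; exact: part_disjoint p1 pz.
Qed.

Lemma weighted_norm_powR :
  (weighted_norm vrho p w f `^ p =
   \int[surface_measure vrho]_(z in conic vrho) (`|f z| `^ p * w z)%:E)%E.
Proof.
rewrite /weighted_norm -poweRrM mulVf ?gt_eqF// poweRe1//.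
by apply: integral_ge0 => z cz; rewrite lee_fin mulr_ge0 ?powR_ge0// ww.2.
Qed.

Lemma weighted_measure_ball_ge0 z :
  (0 <= weighted_measure vrho w (conic_ball vrho z eps))%E.
Proof. by apply: integral_ge0 => y [cy _ _]; rewrite lee_fin ww.2. Qed.

Lemma sum_sup_le_norm : eps <= n%:R^-1 ->
  (\esum_(z in Xi)
     (ereal_sup [set (`|f y| `^ p)%:E | y in conic_ball vrho z eps] *
      weighted_measure vrho w (conic_ball vrho z eps)) <=
   (upper_const B j L p)%:E * weighted_norm vrho p w f `^ p)%E.
Proof.
move=> epsn; rewrite weighted_norm_powR integral_conic ge0_muleDr.
- rewrite esum_conic.
    by apply: leeD; exact: part_sum_sup_le.
  move=> z Xz; rewrite mule_ge0 ?weighted_measure_ball_ge0//.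
  apply: (@le_trans _ _ (`|f z| `^ p)%:E); first by rewrite lee_fin powR_ge0.
  apply: ereal_sup_ubound; exists z => //.
  have [b pz] : exists b, part vrho b z.
    by case: (conic_part (XiC Xz)) => ?; [exists true|exists false].
  rewrite (conic_ballE vrho0 _ pz); split => //.
  by rewrite (part_distxx pz) ltW.
- by apply: integral_ge0 => z pz; rewrite lee_fin mulr_ge0 ?powR_ge0// (w0 pz).
- by apply: integral_ge0 => z pz; rewrite lee_fin mulr_ge0 ?powR_ge0// (w0 pz).
Qed.

Lemma norm_le_sum_inf del : eps <= del * n%:R^-1 -> 0 <= del <= 1 ->
  (4 * local_const R J B * del) `^ p * upper_const B j L p <= 1 / 2 ->
  2 * del <= (2 ^+ j)^-1 ->
  (forall y, conic vrho y -> exists2 z, Xi z & conic_ball vrho z eps y) ->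
  (weighted_norm vrho p w f `^ p <=
   (2 * 2 `^ p)%:E * \esum_(z in Xi)
     (ereal_inf [set (`|f y| `^ p)%:E | y in conic_ball vrho z eps] *
      weighted_measure vrho w (conic_ball vrho z eps)))%E.
Proof.
move=> epsdel del01 small delj cov; rewrite weighted_norm_powR integral_conic.
have g0 z : (0 <= ereal_inf [set (`|f y| `^ p)%:E | y in conic_ball vrho z eps] *
      weighted_measure vrho w (conic_ball vrho z eps))%E.
  rewrite mule_ge0 ?weighted_measure_ball_ge0//.
  by apply: le_ereal_inf_tmp => _ [y _ <-]; rewrite lee_fin powR_ge0.
rewrite esum_conic// ge0_muleDr; try exact: esum_ge0.
by apply: leeD; exact: part_le_sum_inf epsdel del01 small delj cov.
Qed.

End fixed_data.

Lemma maximal_cover (eps : R) Xi : maximal vrho eps Xi ->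
  forall y, conic vrho y -> exists2 z, Xi z & conic_ball vrho z eps y.
Proof.
move=> [c _ Hc] y cy; apply: contrapT => nocov.
have /andP[+ _] := Hc y cy; rewrite esum1 ?lee_fin ?ler10// => z Xz.
by rewrite indicE memNset// => yz; apply: nocov; exists z.
Qed.

End conic_inequalities.

(* The constants enter as p-th powers, i.e. they are the constants of the
   inequalities between p-th roots: with a constant not growing with p, the
   inequalities fail as p tends to infinity. *)
Theorem theorem3p17 (R : realType) (d : nat) (vrho : R) (hd : (2 <= d)%N)
    (hvrho : 0 <= vrho) :
  (forall c : R, 0 < c ->
   exists (p0 : R) (K : R -> R -> R),
   [/\ 0 < p0, forall L p, 0 < K L p,
       forall L p, p0 <= p -> K L p = K L p0 &
     forall w : 'rV[R]_d * R -> R,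
       weight vrho w -> doubling vrho w -> even_on_conic vrho w ->
     forall (n : nat) (delta : R) (Xi : set ('rV[R]_d * R)),
       (0 < n)%N -> 0 < delta <= 1 ->
       symmetric_maximal_separated vrho (delta / n%:R) Xi ->
     forall (p : R) (m : nat) (f : 'rV[R]_d * R -> R),
       0 < p -> (n <= m)%N -> m%:R <= c * n%:R -> even_polynomials vrho m f ->
     (\esum_(z in Xi)
        (ereal_sup [set (`|f y| `^ p)%:E | y in conic_ball vrho z (delta / n%:R)]
         * weighted_measure vrho w (conic_ball vrho z (delta / n%:R)))
      <= (K (doubling_constant vrho w) p `^ p)%:E
         * weighted_norm vrho p w f `^ p)%E]) /\
  (exists (r0 : R) (K : R -> R -> R),
   [/\ 0 < r0 < 1, forall L r, 0 < K L r,
       forall L r, r0 <= r -> K L r = K L r0 &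
     forall w : 'rV[R]_d * R -> R,
       weight vrho w -> doubling vrho w -> even_on_conic vrho w ->
     forall r : R, 0 < r < 1 ->
     exists2 delta_r : R, 0 < delta_r &
     forall (n : nat) (delta : R) (Xi : set ('rV[R]_d * R)),
       (0 < n)%N -> 0 < delta <= 1 ->
       symmetric_maximal_separated vrho (delta / n%:R) Xi ->
       delta <= delta_r ->
     forall (p : R) (f : 'rV[R]_d * R -> R),
       r <= p -> even_polynomials vrho n f ->
     (weighted_norm vrho p w f `^ p
      <= (K (doubling_constant vrho w) r `^ p)%:E
         * \esum_(z in Xi)
        (ereal_inf [set (`|f y| `^ p)%:E | y in conic_ball vrho z (delta / n%:R)]
         * weighted_measure vrho w (conic_ball vrho z (delta / n%:R))))%E]).
Proof.
split.
  (* polynomials of degree at most c n have degree at most J n *)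
  move=> c c0; pose J := (Num.truncn c).+1.
  have /choice[Kf HK] : forall Lq : R * R, exists K : R, 0 < K /\
      (1 <= Lq.1 -> 0 < Lq.2 -> exists B j,
        [/\ (0 < B)%N, local_const R J B <= 2 ^+ j / 2 &
         forall p, Lq.2 <= p ->
           2 * Lq.1 <= (2 ^+ B) `^ p /\ upper_const B j Lq.1 p <= K `^ p]).
    move=> [L q] /=; have [[L1 q0]|no] := pselect (1 <= L /\ 0 < q); last first.
      by exists 1; split => // L1 q0; exfalso; apply: no.
    have [B [j [K [B0 Cj K0 HK]]]] := exists_constants J L1 q0.
    by exists K; split => // _ _; exists B, j.
  exists 1, (fun L p => Kf (Num.max 1 (L + 1), Num.min p 1)); split => //.
  - by move=> L p; have [] := HK (Num.max 1 (L + 1), Num.min p 1).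
  - by move=> L p p1; rewrite minxx min_r.
  move=> w ww dw _ n delta Xi n0 /andP[delta0 delta1] [XiC Xisep _ _].
  move=> p m f p0 nm mc fe.
  have [K0] := HK (Num.max 1 (doubling_constant vrho w + 1), Num.min p 1).
  set K := Kf _ in K0 *.
  have L1 : 1 <= Num.max 1 (doubling_constant vrho w + 1) by rewrite le_max lexx.
  have q0 : 0 < Num.min p 1 by rewrite lt_min p0 ltr01.
  move=> /= /(_ L1 q0)[B [j [B0 Cj HKp]]].
  have [|Bp Kp] := HKp p; first by rewrite ge_min lexx.
  have wL := doubling_constant_bound ww dw.
  have n0' : 0 < n%:R :> R by rewrite ltr0n.
  have fJ : even_polynomials vrho (J * n) f.
    apply: even_polynomials_le fe; rewrite -(ler_nat R) natrM.
    by apply: le_trans mc _; rewrite ler_pM2r// ltW// truncnS_gt.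
  have eps0 : 0 < delta / n%:R by rewrite divr_gt0.
  have epsn : delta / n%:R <= n%:R^-1 by rewrite ler_piMl// invr_ge0 ltW.
  apply: le_trans (sum_sup_le_norm hvrho ww wL L1 n0 B0 fJ Cj p0 Bp eps0 XiC
    Xisep epsn) _.
  by apply: lee_wpmul2r; rewrite ?poweR_ge0// lee_fin.
exists (1 / 2), (fun _ r => 2 * 2 `^ (Num.min r (1 / 2))^-1); split => //.
- by rewrite divr_gt0//= ltr_pdivrMr// mul1r ltr1n.
- by move=> _ r r1; rewrite /= minxx min_r.
move=> w ww dw _ r /andP[r0 r1].
have wL := doubling_constant_bound ww dw; set L := Num.max 1 _ in wL.
have L1 : 1 <= L by rewrite le_max lexx.
have [B [j [K [B0 Cj K0 HK]]]] := exists_constants 1 L1 r0.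
have C0 : 0 <= local_const R 1 B by rewrite addr_ge0// mulr_ge0// exprn_ge0.
have j0 : 0 < 2 ^+ j :> R by rewrite exprn_gt0.
(* s ^ p <= 1 / 2 for all p >= r *)
pose s : R := (1 / 2) `^ r^-1.
have s0 : 0 < s by rewrite powR_gt0.
(* the summand 1 only ensures a > 0 *)
pose a : R := 4 * local_const R 1 B * K + 1.
have a0 : 0 < a by rewrite ltr_pwDr// mulr_ge0 ?mulr_ge0// ltW.
exists (Num.min (s / a) ((2 ^+ j)^-1 / 2)).
  by rewrite lt_min !divr_gt0// invr_gt0.
move=> n delta Xi n0 /andP[delta0 delta1] [XiC Xisep Ximax _].
rewrite le_min => /andP[deltas deltaj] p f rp fe.
have p0 : 0 < p by exact: lt_le_trans rp.
have [Bp Kp] := HK p rp.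
have eps0 : 0 < delta / n%:R by rewrite divr_gt0// ltr0n.
have fJ : even_polynomials vrho (1 * n) f by rewrite mul1n.
have small : (4 * local_const R 1 B * delta) `^ p * upper_const B j L p <= 1 / 2.
  apply: le_trans (ler_wpM2l (powR_ge0 _ _) Kp) _.
  rewrite -powRM ?mulr_ge0 ?(ltW delta0) ?(ltW K0)//.
  have half0 : 0 < 1 / 2 :> R by rewrite divr_gt0.
  apply: le_trans (@powR_le_root R (1 / 2) r p half0 _ r0 rp); last first.
    by rewrite ler_pdivrMr// mul1r ler1n.
  rewrite -/s; apply: (ge0_ler_powR (ltW p0)).
  - by rewrite nnegrE !mulr_ge0// ltW.
  - by rewrite nnegrE ltW.
  move: deltas; rewrite ler_pdivlMr// /a => deltas; apply: le_trans deltas.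
  by rewrite -subr_ge0 (_ : _ - _ = delta) ?ltW//; ring.
have delj : 2 * delta <= (2 ^+ j)^-1 by rewrite mulrC -ler_pdivlMr.
have del01 : 0 <= delta <= 1 by rewrite ltW.
have := norm_le_sum_inf hvrho ww wL L1 n0 B0 fJ Cj p0 Bp eps0 XiC Xisep
  (lexx _) del01 small delj (maximal_cover Ximax).
move=> /le_trans; apply; apply: lee_wpmul2r.
  apply: esum_ge0 => z _; rewrite mule_ge0 ?weighted_measure_ball_ge0//.
  by apply: le_ereal_inf_tmp => _ [y _ <-]; rewrite lee_fin powR_ge0.
have q0 : 0 < Num.min r (1 / 2) by rewrite lt_min r0 divr_gt0.
have qp : Num.min r (1 / 2) <= p by apply: le_trans rp; rewrite ge_min lexx.
rewrite lee_fin powRM ?powR_ge0// mulrC ler_wpM2l ?powR_ge0//.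
by apply: powR_ge_root => //; rewrite ler1n.
Qed.
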